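(* Let $G$ be a finitely generated, large group and let $g_1, \dots, g_r$ be a collection of elements of $G$. Then for infinitely many integers $n$, the group $G/\langle\langle g_1^n, \dots, g_r^n \rangle\rangle$ is also large. Indeed, if $H$ is any finite index normal subgroup of $G$ that admits a surjective homomorphism onto a non-abelian free group, then $G/\langle\langle g_1^n, \dots, g_r^n \rangle\rangle$ is large whenever $n$ is any sufficiently large multiple of the index $[G:H]$.
   Context: A group $G$ is large if some finite index subgroup of $G$ admits a surjective homomorphism onto a non-abelian free group. For elements $x_1,\dots,x_k$ of a group $G$, $\langle\langle x_1,\dots,x_k\rangle\rangle$ denotes the subgroup of $G$ normally generated by $x_1,\dots,x_k$ (the normal closure of $\{x_1,\dots,x_k\}$ in $G$). *)

(* Defs.v *)
From HB Require Import structures.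
From mathcomp Require Import all_boot finmap all_classical.

Set Implicit Arguments.
Unset Strict Implicit.
Unset Printing Implicit Defensive.

Local Open Scope fset_scope.
Local Open Scope classical_set_scope.
Local Open Scope group_scope.
Local Open Scope quotient_scope.

Section Subgroups.
Variable G : groupType.
Implicit Types A H : set G.

Definition is_subgroup H : Prop :=
  [/\ H 1, forall x y, H x -> H y -> H (x * y) & forall x, H x -> H x^-1].

Definition is_normal_subgroup H : Prop :=
  is_subgroup H /\ forall x y, H x -> H (x ^ y).

Definition generated A : set G := smallest is_subgroup A.

Definition normal_closure A : set G := smallest is_normal_subgroup A.

Definition lcoset_set H (x : G) : set G := [set x * h | h in H].

Definition lcoset_space H : set (set G) := range (lcoset_set H).

Definition finite_index H : Prop :=
  is_subgroup H /\ finite_set (lcoset_space H).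

(* Meaningful only if [finite_index H]: [fset_set] sends infinite sets to
   the empty finite set. *)
Definition subgroup_index H : nat := #|` fset_set (lcoset_space H)|.

End Subgroups.

Definition finitely_generated (G : groupType) : Prop :=
  exists2 A : set G, finite_set A & generated A = setT.

(* Only the values of f on B matter. *)
Definition free_basis (F : groupType) (B : set F) : Prop :=
  forall (K : groupType) (f : F -> K), exists! phi : F -> K,
    {morph phi : x y / x * y} /\ {in B, phi =1 f}.

Definition is_free (F : groupType) : Prop := exists B : set F, free_basis B.

Definition non_abelian (F : groupType) : Prop :=
  exists x y : F, x * y <> y * x.

(* A homomorphism from H to F is represented by a function on G that is
   multiplicative on H; its values outside H are irrelevant. *)
Definition maps_onto_non_abelian_free (G : groupType) (H : set G) : Prop :=
  exists (F : groupType) (f : G -> F),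
    [/\ is_free F, non_abelian F, {in H &, {morph f : x y / x * y}}
      & f @` H = setT].

Definition large (G : groupType) : Prop :=
  exists2 H : set G, finite_index H & maps_onto_non_abelian_free H.

Section NormalClosureQuotient.
Variables (G : groupType) (A : set G).

Lemma normal_closure_normal : is_normal_subgroup (normal_closure A).
Proof.
split; first split.
- by move=> N [[[]]].
- move=> x y Hx Hy N NA; have [[[_ NM _] _] _] := NA.
  by apply: NM; [exact: Hx | exact: Hy].
- move=> x Hx N NA; have [[[_ _ NV] _] _] := NA.
  by apply: NV; exact: Hx.
- move=> x y Hx N NA; have [[_ NJ] _] := NA.
  by apply: NJ; exact: Hx.
Qed.

Definition nc_equiv : rel G := fun x y => `[< normal_closure A (x^-1 * y) >].

Let nc1 : normal_closure A 1.
Proof. by have [[]] := normal_closure_normal. Qed.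

Let ncM x y :
  normal_closure A x -> normal_closure A y -> normal_closure A (x * y).
Proof. by have [[_ + _] _] := normal_closure_normal; apply. Qed.

Let ncV x : normal_closure A x -> normal_closure A x^-1.
Proof. by have [[_ _ +] _] := normal_closure_normal; apply. Qed.

Let ncJ x y : normal_closure A x -> normal_closure A (x ^ y).
Proof. by have [_ +] := normal_closure_normal; apply. Qed.

Lemma nc_equiv_is_equiv : equiv_class_of nc_equiv.
Proof.
split.
- by move=> x; apply/asboolP; rewrite mulVg.
- by move=> x y; apply/asboolP/asboolP => /ncV; rewrite invgM invgK.
- move=> y x z /asboolP xy /asboolP yz; apply/asboolP.
  by have := ncM xy yz; rewrite mulgA mulgK.
Qed.

Canonical nc_equiv_equiv := EquivRelPack nc_equiv_is_equiv.
Canonical nc_equiv_encModRel := defaultEncModRel nc_equiv.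

Definition nc_quotient := {eq_quot nc_equiv}.

HB.instance Definition _ := Choice.on nc_quotient.
HB.instance Definition _ := EqQuotient.on nc_quotient.

Let piP x y :
  (\pi_nc_quotient x = \pi_nc_quotient y) <-> normal_closure A (x^-1 * y).
Proof.
by split=> [/eqquotP/asboolP|xy]; last by apply/eqquotP/asboolP.
Qed.

Definition nc_mul (a b : nc_quotient) : nc_quotient := \pi_nc_quotient (repr a * repr b).
Definition nc_one : nc_quotient := \pi_nc_quotient 1.
Definition nc_inv (a : nc_quotient) : nc_quotient := \pi_nc_quotient (repr a)^-1.

Let repr_pi x : normal_closure A (x^-1 * repr (\pi_nc_quotient x)).
Proof. by apply/piP; rewrite reprK. Qed.

Let mulqE x y : nc_mul (\pi_nc_quotient x) (\pi_nc_quotient y) = \pi_nc_quotient (x * y).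
Proof.
apply/esym/piP; set x' := repr _; set y' := repr _.
have -> : (x * y)^-1 * (x' * y') = (x^-1 * x') ^ y * (y^-1 * y').
  by rewrite /conjg invgM !mulgA mulgK.
by apply: ncM; [apply: ncJ|]; exact: repr_pi.
Qed.

Let invqE x : nc_inv (\pi_nc_quotient x) = \pi_nc_quotient x^-1.
Proof.
apply/piP; set x' := repr _; rewrite invgK.
have -> : x' * x^-1 = (x^-1 * x') ^ x^-1.
  by rewrite /conjg invgK !mulgA mulgV mul1g.
by apply: ncJ; exact: repr_pi.
Qed.

Let mulqA : associative nc_mul.
Proof.
move=> a b c; rewrite -[a]reprK -[b]reprK -[c]reprK.
move: (repr a) (repr b) (repr c) => x y z.
by rewrite (mulqE y) (mulqE x y) (mulqE x) (mulqE (x * y)) mulgA.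
Qed.

Let mul1q : left_id nc_one nc_mul.
Proof. by move=> a; rewrite -[a]reprK /nc_one mulqE mul1g. Qed.

Let mulq1 : right_id nc_one nc_mul.
Proof. by move=> a; rewrite -[a]reprK /nc_one mulqE mulg1. Qed.

Let mulVq : left_inverse nc_one nc_inv nc_mul.
Proof. by move=> a; rewrite -[a]reprK invqE mulqE mulVg. Qed.

Let mulqV : right_inverse nc_one nc_inv nc_mul.
Proof. by move=> a; rewrite -[a]reprK invqE mulqE mulgV. Qed.

HB.instance Definition _ :=
  isGroup.Build nc_quotient mulqA mul1q mulq1 mulVq mulqV.

Lemma nc_quotient_piM : {morph \pi_nc_quotient : x y / x * y}.
Proof. by move=> x y; rewrite -mulqE. Qed.

Lemma nc_quotient_pi_surj (a : nc_quotient) : exists x, \pi_nc_quotient x = a.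
Proof. by exists (repr a); rewrite reprK. Qed.

Lemma nc_quotient_ker x : \pi_nc_quotient x = 1 <-> normal_closure A x.
Proof.
split=> [/esym/piP|nx]; first by rewrite invg1 mul1g.
by apply/esym/piP; rewrite invg1 mul1g.
Qed.

End NormalClosureQuotient.

(* Main.v *)
Require Import Defs.
From HB Require Import structures.
From mathcomp Require cyclic.
From mathcomp Require Import all_fingroup all_boot all_algebra finmap all_classical.
From mathcomp Require Import zify ring.

(** Let H be a finite index subgroup of G that maps onto a non-abelian free
    group, hence onto the free group F2 of rank two, and let N be such that
    g ^ N lies in H for every g; for normal H the index will do, by Lagrange.
    The conjugates of the g_i ^ N have, up to conjugacy in F2, only finitely
    many images f_1, ..., f_k in F2, and a homomorphism that kills every
    f_j ^ m kills the normal closure of the g_i ^ (N * m).  So the theorem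
    reduces to [free_power_quotient]: for all large m, the quotient of F2 by
    the f_j ^ m is large (those f_j that are trivial may be forgotten).

    The Magnus representation gives, for all large m, a finite quotient P of
    F2 of exponent dividing m in which each f_j has order more than k
    ([finite_exponent_quotients]).  Let X be a finite F2-set, such as P, on
    which f_j ^ m is trivial and the orbits of f_j have more than k points.  An
    integral cocycle on X is given by its 2 * #|X| values on the generators.
    On f_j ^ m it takes a value invariant under f_j, so that killing f_j ^ m
    costs one linear condition for each orbit, at most #|X| / (k + 1) of them
    for each j.  Coboundaries account for at most #|X| dimensions; so there is
    a cocycle which kills every f_j ^ m and is not a coboundary
    ([cocycle_solution]).

    This is used twice, in the spirit of the theorem of Baumslag and Pride on
    groups with two more generators than relations.  On P it yields a height D
    that maps point stabilizers onto the integers ([height_cocycle]).  The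
    second use is on the cyclic covering P x Z/n of P given by D: for n large,
    the count leaves room to require that the cocycle E vanish on the edges
    near the cut between n - 1 and 0, and that E be no combination of D
    and coboundaries.  Writing F2 = <A, T>, let a path in the infinite covering
    P x Z collect a power of A, with exponent given by E, on each of its edges,
    conjugated by T ^ q when the edge lies over the q-th interval of length n.
    The path of f_j ^ m is short compared to the windows where E vanishes, so
    it meets only one interval; it collects a power of a conjugate of A whose
    exponent is the value of E on f_j ^ m, which is 0 ([monodromy_local]).  The
    collected element, corrected by a power of T, defines a homomorphism to F2
    on the stabilizer of a point of P x Z/n.  Were its image commutative, E
    would be a multiple of D up to a coboundary ([monodromy_noncommuting]).
    Finally the image is free by the Nielsen-Schreier theorem
    ([subgroup_free]). *)

Set Implicit Arguments.
Unset Strict Implicit.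
Unset Printing Implicit Defensive.

Import GRing.Theory Num.Theory.

Local Open Scope quotient_scope.
Local Open Scope group_scope.

(** * The free group of rank two *)

Section FreeGroup.

Definition word := seq (bool * bool).

Definition letter_val (K : groupType) (f : bool -> K) (l : bool * bool) : K :=
  if l.2 then (f l.1)^-1 else f l.1.

Definition word_val (K : groupType) (f : bool -> K) (w : word) : K :=
  \prod_(l <- w) letter_val f l.

Lemma word_val_cat (K : groupType) (f : bool -> K) w1 w2 :
  word_val f (w1 ++ w2) = word_val f w1 * word_val f w2.
Proof. by rewrite /word_val big_cat. Qed.

Definition word_inv (w : word) : word := rev [seq (l.1, ~~ l.2) | l <- w].

Lemma word_val_inv (K : groupType) (f : bool -> K) w :
  word_val f (word_inv w) = (word_val f w)^-1.
Proof.
rewrite /word_val /word_inv; apply: invg_inj.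
rewrite -prodgV invgK big_map /letter_val.
by apply: eq_bigr => -[b []] _ //=; rewrite invgK.
Qed.

(** Identifying words with the same value in all groups gives the universal
    property by construction; which words are trivial is settled later, by the
    Magnus representation. *)
Definition word_equiv : rel word := fun w1 w2 =>
  `[< forall (K : groupType) (f : bool -> K), word_val f w1 = word_val f w2 >].

Lemma word_equiv_is_equiv : equiv_class_of word_equiv.
Proof.
split.
- by move=> w; apply/asboolP.
- by move=> w1 w2; apply/asboolP/asboolP => E K f; rewrite E.
- move=> w2 w1 w3 /asboolP E1 /asboolP E2; apply/asboolP => K f.
  by rewrite E1 E2.
Qed.

Canonical word_equiv_equiv := EquivRelPack word_equiv_is_equiv.
Canonical word_equiv_encModRel := defaultEncModRel word_equiv.

Definition F2 := {eq_quot word_equiv}.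

HB.instance Definition _ := Choice.on F2.
HB.instance Definition _ := EqQuotient.on F2.

Definition F2_lift (K : groupType) (f : bool -> K) (u : F2) : K :=
  word_val f (repr u).

Lemma F2_lift_pi (K : groupType) (f : bool -> K) w :
  F2_lift f (\pi_F2 w) = word_val f w.
Proof.
have /eqquotP/asboolP : \pi_F2 (repr (\pi_F2 w)) = \pi_F2 w by rewrite reprK.
by apply.
Qed.

Lemma F2_lift_ext (u v : F2) :
  (forall (K : groupType) (f : bool -> K), F2_lift f u = F2_lift f v) -> u = v.
Proof.
by move=> E; rewrite -[u]reprK -[v]reprK; apply/eqquotP/asboolP; exact: E.
Qed.

Definition F2_mul (u v : F2) : F2 := \pi_F2 (repr u ++ repr v).
Definition F2_one : F2 := \pi_F2 [::].
Definition F2_inv (u : F2) : F2 := \pi_F2 (word_inv (repr u)).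

Lemma F2_lift_mul (K : groupType) (f : bool -> K) u v :
  F2_lift f (F2_mul u v) = F2_lift f u * F2_lift f v.
Proof. by rewrite F2_lift_pi word_val_cat. Qed.

Lemma F2_lift_one (K : groupType) (f : bool -> K) : F2_lift f F2_one = 1.
Proof. by rewrite F2_lift_pi /word_val big_nil. Qed.

Lemma F2_lift_inv (K : groupType) (f : bool -> K) u :
  F2_lift f (F2_inv u) = (F2_lift f u)^-1.
Proof. by rewrite F2_lift_pi word_val_inv. Qed.

Let F2_liftE := (F2_lift_mul, F2_lift_one, F2_lift_inv).

Lemma F2_mulA : associative F2_mul.
Proof. by move=> u v w; apply: F2_lift_ext => K f; rewrite !F2_liftE mulgA. Qed.
Lemma F2_mul1 : left_id F2_one F2_mul.
Proof. by move=> u; apply: F2_lift_ext => K f; rewrite !F2_liftE mul1g. Qed.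
Lemma F2_mulr1 : right_id F2_one F2_mul.
Proof. by move=> u; apply: F2_lift_ext => K f; rewrite !F2_liftE mulg1. Qed.
Lemma F2_mulV : left_inverse F2_one F2_inv F2_mul.
Proof. by move=> u; apply: F2_lift_ext => K f; rewrite !F2_liftE mulVg. Qed.
Lemma F2_mulrV : right_inverse F2_one F2_inv F2_mul.
Proof. by move=> u; apply: F2_lift_ext => K f; rewrite !F2_liftE mulgV. Qed.

HB.instance Definition _ :=
  isGroup.Build F2 F2_mulA F2_mul1 F2_mulr1 F2_mulV F2_mulrV.

Definition gen (b : bool) : F2 := \pi_F2 [:: (b, false)].

Lemma F2_lift_gen (K : groupType) (f : bool -> K) b : F2_lift f (gen b) = f b.
Proof. by rewrite F2_lift_pi /word_val big_seq1. Qed.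

HB.instance Definition _ (K : groupType) (f : bool -> K) :=
  isUMagmaMorphism.Build F2 K (F2_lift f) (conj (F2_lift_one f) (F2_lift_mul f)).

Lemma word_val_gen w : word_val gen w = \pi_F2 w.
Proof.
apply: F2_lift_ext => K f; rewrite F2_lift_pi /word_val gmulf_prod.
by apply: eq_bigr => -[b []] _; rewrite /letter_val /= ?gmulfV /= F2_lift_gen.
Qed.

Lemma F2_ind (P : F2 -> Prop) :
  P 1 -> (forall u b, P u -> P (gen b * u)) ->
  (forall u b, P u -> P ((gen b)^-1 * u)) -> forall u, P u.
Proof.
move=> P1 PM PV u; rewrite -[u]reprK -word_val_gen /word_val.
elim: (repr u) => [|[b e] w IH]; first by rewrite big_nil.
by rewrite big_cons; case: e => /=; [exact: PV|exact: PM].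
Qed.

End FreeGroup.

(** * Cocycles for right actions *)

Section Morph.
Variables (G K : groupType) (f : G -> K).
Hypothesis fM : {morph f : x y / x * y}.

Lemma morph_1 : f 1 = 1.
Proof. by apply: (mulgI (f 1)); rewrite -fM !mulg1. Qed.

Lemma morph_V : {morph f : x / x^-1}.
Proof. by move=> x; apply: (mulgI (f x)); rewrite -fM !mulgV morph_1. Qed.

Lemma morph_X n : {morph f : x / x ^+ n}.
Proof.
by move=> x; elim: n => [|n IH]; rewrite ?expg0 ?morph_1 // !expgS fM IH.
Qed.

End Morph.

Section SubgroupMorph.
Variables (G K : groupType) (H : set G) (f : G -> K).
Hypothesis sH : is_subgroup H.
Hypothesis fM : forall x y, H x -> H y -> f (x * y) = f x * f y.

Lemma subgroup_morph1 : f 1 = 1.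
Proof. by have [H1 _ _] := sH; apply: (mulgI (f 1)); rewrite -fM // !mulg1. Qed.

Lemma subgroup_morphV x : H x -> f x^-1 = (f x)^-1.
Proof.
have [_ _ HV] := sH => Hx; apply/esym/mulg1_eq.
by rewrite -fM ?mulgV ?subgroup_morph1 //; exact: HV.
Qed.

Lemma subgroup_X x n : H x -> H (x ^+ n).
Proof.
have [H1 HM _] := sH => Hx.
by elim: n => [|n IH]; rewrite ?expg0 // expgS; exact: HM.
Qed.

Lemma subgroup_morphX x n : H x -> f (x ^+ n) = f x ^+ n.
Proof.
move=> Hx; elim: n => [|n IH]; first exact: subgroup_morph1.
by rewrite !expgS fM ?IH //; exact: subgroup_X.
Qed.

Lemma subgroup_morphJ x y : H x -> H y -> f (x ^ y) = f x ^ f y.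
Proof.
have [_ HM HV] := sH => Hx Hy; rewrite /conjg fM.
- by rewrite fM // subgroup_morphV.
- exact: HV.
- exact: HM.
Qed.

End SubgroupMorph.

Lemma F2_morph_ext (K : groupType) (f h : F2 -> K) :
  {morph f : x y / x * y} -> {morph h : x y / x * y} ->
  (forall b, f (gen b) = h (gen b)) -> f =1 h.
Proof.
move=> fM hM E; elim/F2_ind=> [|u b IH|u b IH].
- by rewrite (morph_1 fM) (morph_1 hM).
- by rewrite fM hM IH E.
- by rewrite fM hM IH (morph_V fM) (morph_V hM) E.
Qed.

Section Action.
Variables (G : groupType) (X : Type).

(** A right action reads a product from left to right, like a path; the value
    of a cocycle is then what is collected along the path. *)
Record right_action := RightAction {
  ract_fun :> X -> G -> X;
  ract1 : forall x, ract_fun x 1 = x;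
  ractM : forall x u v, ract_fun x (u * v) = ract_fun (ract_fun x u) v }.

Variable a : right_action.

Lemma ractK u : cancel (a^~ u) (a^~ u^-1).
Proof. by move=> x; rewrite -ractM mulgV ract1. Qed.

Lemma ractKV u : cancel (a^~ u^-1) (a^~ u).
Proof. by move=> x; rewrite -ractM mulVg ract1. Qed.

Lemma ract_fixX u x n : a x u = x -> a x (u ^+ n) = x.
Proof.
by move=> E; elim: n => [|n IH]; rewrite ?expg0 ?ract1 // expgS ractM E.
Qed.

Definition stab (x : X) : set G := [set u | a x u = x].

Definition transitive_from (x0 : X) := forall x, exists u, a x0 u = x.

End Action.
Arguments stab {G X} a x.

Lemma stab_subgroup (G : groupType) (X : Type) (a : right_action G X) x :
  is_subgroup (stab a x).
Proof.
split=> [|u v Su Sv|u Su]; rewrite /stab /=; first exact: ract1.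
  by rewrite ractM Su.
by rewrite -{1}Su ractK.
Qed.

Section Cocycle.
Variables (G : groupType) (X : Type) (a : right_action G X) (B : groupType).

Definition cocycle (c : G -> X -> B) :=
  forall u v x, c (u * v) x = c u x * c v (a x u).

Variables (c : G -> X -> B) (cM : cocycle c).

Lemma cocycle_1 x : c 1 x = 1.
Proof. by apply: (mulgI (c 1 x)); rewrite -{2}(ract1 a x) -cM !mulg1. Qed.

Lemma cocycle_V u x : c u^-1 x = (c u (a x u^-1))^-1.
Proof.
apply: (mulIg (c u (a x u^-1))).
by rewrite -cM !mulVg cocycle_1.
Qed.

Lemma cocycle_stabX u x n : a x u = x -> c (u ^+ n) x = c u x ^+ n.
Proof.
by move=> E; elim: n => [|n IH]; rewrite ?expg0 ?cocycle_1 // !expgS cM E IH.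
Qed.

Lemma cocycle_conj u v x :
  a (a x v^-1) u = a x v^-1 -> c (u ^ v) x = c u (a x v^-1) ^ c v (a x v^-1).
Proof.
by move=> E; rewrite /conjg !cM E (cocycle_V v).
Qed.

End Cocycle.

Section SemidirectProduct.
(** The action enters through the multiplication below; as a parameter of the
    type it lets the group structure be inferred. *)
Definition sdprod (G : groupType) (X : Type) (a : right_action G X) (B : groupType) :
  Type := (X -> B) * G.

Variables (G : groupType) (X : Type) (a : right_action G X) (B : groupType).
Local Notation sdp := (sdprod a B).

HB.instance Definition _ := gen_eqMixin sdp.
HB.instance Definition _ := gen_choiceMixin sdp.

Definition sd_mul (s t : sdp) : sdp :=
  (fun x => s.1 x * t.1 (a x s.2), s.2 * t.2).
Definition sd_one : sdp := (fun=> 1, 1).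
Definition sd_inv (s : sdp) : sdp :=
  (fun x => (s.1 (a x s.2^-1))^-1, s.2^-1).

Lemma sd_mulA : associative sd_mul.
Proof.
move=> s t r; congr pair; rewrite ?mulgA //.
by apply/funext=> x /=; rewrite ractM mulgA.
Qed.
Lemma sd_mul1 : left_id sd_one sd_mul.
Proof.
move=> [s u]; congr pair => /=; rewrite ?mul1g //.
by apply/funext=> x; rewrite ract1 mul1g.
Qed.
Lemma sd_mulr1 : right_id sd_one sd_mul.
Proof.
by move=> [s u]; congr pair => /=; rewrite ?mulg1 //; apply/funext=> x; rewrite mulg1.
Qed.
Lemma sd_mulV : left_inverse sd_one sd_inv sd_mul.
Proof.
move=> [s u]; congr pair => /=; rewrite ?mulVg //.
by apply/funext=> x; rewrite mulVg.
Qed.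
Lemma sd_mulrV : right_inverse sd_one sd_inv sd_mul.
Proof.
move=> [s u]; congr pair => /=; rewrite ?mulgV //.
by apply/funext=> x; rewrite ractK mulgV.
Qed.

HB.instance Definition _ :=
  isGroup.Build sdp sd_mulA sd_mul1 sd_mulr1 sd_mulV sd_mulrV.

End SemidirectProduct.

Section FreeCocycle.
Variables (X : Type) (a : right_action F2 X) (B : groupType).

(** The maps u |-> (c u, u) with c a cocycle are the homomorphic sections of the
    semidirect product, and these can be prescribed freely on generators. *)
Lemma F2_cocycle_exists (e : bool -> X -> B) :
  exists2 c : F2 -> X -> B, cocycle a c & forall b, c (gen b) = e b.
Proof.
pose h : F2 -> sdprod a B := F2_lift (fun b => (e b, gen b) : sdprod a B).
have hM : {morph h : u v / u * v} by move=> u v; rewrite /h gmulfM.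
have h2 u : (h u).2 = u.
  apply: (F2_morph_ext (f := fun u => (h u).2) (h := id)) => //.
    by move=> {}u v; rewrite hM.
  by move=> b; rewrite /h F2_lift_gen.
exists (fun u => (h u).1); last by move=> b; rewrite /h F2_lift_gen.
by move=> u v x; rewrite hM /= h2.
Qed.

Lemma F2_cocycle_ext (c d : F2 -> X -> B) : cocycle a c -> cocycle a d ->
  (forall b x, c (gen b) x = d (gen b) x) -> forall u x, c u x = d u x.
Proof.
move=> cM dM E; elim/F2_ind=> [|u b IH|u b IH] x.
- by rewrite (cocycle_1 cM) (cocycle_1 dM).
- by rewrite cM dM E IH.
- by rewrite cM dM (cocycle_V cM) (cocycle_V dM) E IH.
Qed.

End FreeCocycle.

Section AdditiveCocycle.

(** Lets additive groups serve as coefficients of cocycles. *)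
Definition multiplicative_copy (V : zmodType) : Type := V.

Variable V : zmodType.

HB.instance Definition _ := Choice.on (multiplicative_copy V).
HB.instance Definition _ := isGroup.Build (multiplicative_copy V)
  (@addrA V) (@add0r V) (@addr0 V) (@addNr V) (@addrN V).

Lemma multiplicative_copyX (x : multiplicative_copy V) n :
  x ^+ n = ((x : V) *+ n)%R.
Proof. by elim: n => [|n IH] //; rewrite expgS mulrS -IH. Qed.

Variables (G : groupType) (X : Type) (a : right_action G X).

Definition zcocycle (c : G -> X -> V) :=
  cocycle a (c : G -> X -> multiplicative_copy V).

Local Open Scope ring_scope.

Lemma zcocycleI (c : G -> X -> V) :
  (forall u v x, c (u * v)%g x = c u x + c v (a x u)) -> zcocycle c.
Proof. by []. Qed.

Variables (c : G -> X -> V) (cM : zcocycle c).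

Lemma zcocycle_M u v x : c (u * v)%g x = c u x + c v (a x u).
Proof. exact: cM. Qed.
Lemma zcocycle_1 x : c 1%g x = 0.
Proof. exact: (cocycle_1 cM). Qed.
Lemma zcocycle_V u x : c u^-1%g x = - c u (a x u^-1%g).
Proof. exact: (cocycle_V cM). Qed.
Lemma zcocycle_stabX u x n : a x u = x -> c (u ^+ n)%g x = c u x *+ n.
Proof. by move=> E; rewrite -multiplicative_copyX; exact: (cocycle_stabX cM). Qed.

End AdditiveCocycle.

(** * The Magnus representation *)

Section IntegerPowers.
Variable K : groupType.

Definition zexpg (x : K) (z : int) : K :=
  match z with Posz n => x ^+ n | Negz n => x ^- n.+1 end.

Lemma zexpgS x z : zexpg x (1 + z) = x * zexpg x z.
Proof.
case: z => [n|[|n]].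
- by rewrite (_ : (1 + Posz n)%R = Posz n.+1) //= expgS.
- by rewrite (_ : (1 + Negz 0)%R = Posz 0) //= expg1 mulgV.
- rewrite (_ : (1 + Negz n.+1)%R = Negz n); last by lia.
  by change (x ^- n.+1 = x * x ^- n.+2); rewrite (expgSr x n.+1) invgM mulVKg.
Qed.

Lemma zexpgP x z : zexpg x (-1 + z) = x^-1 * zexpg x z.
Proof. by rewrite -{2}[z](addKr (-1)%R) opprK zexpgS mulKg. Qed.

Lemma zexpgD x y z : zexpg x (y + z) = zexpg x y * zexpg x z.
Proof.
case: y => n.
  elim: n => [|n IH]; first by rewrite add0r mul1g.
  rewrite (_ : Posz n.+1 = 1 + Posz n)%R; last by lia.
  by rewrite -addrA !zexpgS IH mulgA.
elim: n => [|n IH].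
  rewrite (_ : Negz 0 = -1)%R; last by lia.
  by rewrite zexpgP.
rewrite (_ : Negz n.+1 = -1 + Negz n)%R; last by lia.
by rewrite -addrA !zexpgP IH mulgA.
Qed.

Lemma zexpgN x z : zexpg x (- z)%R = (zexpg x z)^-1.
Proof. by apply/esym/mulg1_eq; rewrite -zexpgD addrN. Qed.

Lemma zexpgJ x y z : zexpg (x ^ y) z = zexpg x z ^ y.
Proof. by case: z => n /=; rewrite ?conjVg conjXg. Qed.

End IntegerPowers.

Section NormalForm.

Definition syllables := seq (bool * int).

Definition syllables_val (w : syllables) : F2 := \prod_(a <- w) zexpg (gen a.1) a.2.

Definition alternating (w : syllables) : bool :=
  sorted (fun a b => a.1 != b.1) w && all (fun a => a.2 != 0%R) w.

(** The case e = 1 or -1 adds a letter in front of a word in normal form; the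
    new syllable may merge with the first one, or cancel it. *)
Lemma alternating_letter b (e : int) w : e != 0%R -> alternating w ->
  exists2 w', alternating w' &
    syllables_val w' = zexpg (gen b) e * syllables_val w.
Proof.
move=> e0; case: w => [|[b' z] w].
  exists [:: (b, e)]; first by rewrite /alternating /= e0.
  by rewrite /syllables_val big_seq1 big_nil mulg1.
rewrite /alternating /= => /andP[sw /andP[z0 aw]].
have [bb'|bb'] := eqVneq b b'; last first.
  exists [:: (b, e), (b', z) & w]; last by rewrite /syllables_val big_cons.
  by rewrite /alternating /= sw bb' e0 z0.
subst b'; have E : zexpg (gen b) e * syllables_val ((b, z) :: w) =
    zexpg (gen b) (e + z)%R * syllables_val w.
  by rewrite /syllables_val big_cons mulgA -zexpgD.
have [ez|ez] := eqVneq (e + z)%R 0%R.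
  exists w; last by rewrite E ez mul1g.
  by rewrite /alternating aw (path_sorted sw).
exists ((b, (e + z)%R) :: w); last by rewrite E /syllables_val big_cons.
by rewrite /alternating /= ez aw !andbT; case: (w) sw.
Qed.

Lemma normal_form (u : F2) : exists2 w, alternating w & syllables_val w = u.
Proof.
elim/F2_ind: u => [|u b [w aw <-]|u b [w aw <-]].
- by exists [::]; rewrite // /syllables_val big_nil.
- by have [//|w' aw' E] := @alternating_letter b 1%R w _ aw; exists w'; rewrite // E.
- have [//|w' aw' E] := @alternating_letter b (-1)%R w _ aw.
  by exists w'; rewrite // E.
Qed.

End NormalForm.

Section Unitriangular.
Local Open Scope ring_scope.
Variables (R : comNzRingType) (k : nat).
Local Notation M := 'M[R]_k.+1.

Definition strictly_upper (A : M) := forall i j : 'I_k.+1, (j <= i)%N -> A i j = 0.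

Lemma strictly_upper_pow (A : M) : strictly_upper A -> A ^+ k.+1 = 0.
Proof.
move=> uA; suff P : forall n (i j : 'I_k.+1), (j < i + n)%N -> (A ^+ n) i j = 0.
  by apply/matrixP=> i j; rewrite P ?mxE //; move: (ltn_ord j); lia.
elim=> [|n IH] i j lt_j.
  by rewrite expr0 mxE; case: eqP lt_j => // ->; rewrite addn0 ltnn.
rewrite exprS mxE big1 // => l _.
have [le_li|lt_il] := leqP l i; first by rewrite uA // mul0r.
by rewrite IH ?mulr0 //; lia.
Qed.

Lemma strictly_upper_mul (A B : M) :
  strictly_upper A -> strictly_upper B -> strictly_upper (A * B).
Proof.
move=> uA uB i j le_ji; rewrite mxE big1 // => l _.
have [le_li|lt_il] := leqP l i; first by rewrite uA // mul0r.
by rewrite uB ?mulr0 //; lia.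
Qed.

(** In the binomial expansion, the terms of degree more than k vanish because A
    is nilpotent, and the other ones because their coefficients do. *)
Lemma unipotent_exponent (A : M) m :
  strictly_upper A -> (forall i, (0 < i <= k)%N -> 'C(m, i)%:R = 0 :> R) ->
  (1 + A) ^+ m = 1.
Proof.
move=> uA Cm; rewrite addrC exprD1n big_ord_recl /= expr0 bin0 big1 ?addr0 // => i _.
rewrite -mulr_natr.
have [le_ik|lt_ki] := leqP i.+1 k.
  have E : 'C(m, i.+1)%:R = ('C(m, i.+1)%:R : R)%:A :> M by rewrite scaler_nat.
  by rewrite E Cm ?scale0r ?mulr0 //.
suff -> : A ^+ i.+1 = 0 by rewrite mul0r.
by rewrite -(subnK lt_ki) exprD strictly_upper_pow // mulr0.
Qed.

End Unitriangular.

Section UnipotentTorsion.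
Local Open Scope ring_scope.

(** From (1 + A) ^ s = 1 + s A + A ^ 2 h, a trivial power gives s A = - A ^ 2 h;
    so each multiplication of A by s produces one more factor A. *)
Lemma unipotent_torsion (S : nzRingType) (A : S) (k s : nat) :
  A ^+ k.+1 = 0 -> (1 + A) ^+ s = 1 -> A *+ (s ^ k) = 0.
Proof.
move=> Ak As.
have [h cAh hE] : exists2 h : S, GRing.comm A h &
    (1 + A) ^+ s = 1 + A *+ s + A * (A * h).
  clear As; elim: s => [|s [h cAh hE]].
    by exists 0; rewrite ?expr0 ?mulr0n ?addr0 ?mulr0 ?addr0 //; exact: commr0.
  exists (s%:R + h * (1 + A)).
    apply: commrD; first exact: commr_nat.
    by apply: commrM => //; apply: commrD; [exact: commr1|].
  have -> : A * (A * (s%:R + h * (1 + A))) = A *+ s * A + A * (A * h) * (1 + A).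
    by rewrite !mulrDr mulrnAl mulr_natr mulrnAr !mulr1 !mulrA.
  by rewrite exprSr hE !mulrDl mul1r mulrSr mulrDr mulr1 -!addrA; congr (_ + _); rewrite addrCA.
have sA : A *+ s = A * (A * - h).
  apply/eqP; rewrite !mulrN -addr_eq0; apply/eqP.
  by apply: (addrI 1); rewrite addrA -hE As addr0.
suff P j : A *+ (s ^ j) = A * (A * - h) ^+ j.
  by rewrite P exprMn_comm; [rewrite mulrA -exprS Ak mul0r|exact: commrN].
elim: j => [|j IH]; first by rewrite expn0 expr0 mulr1.
by rewrite expnSr mulrnA IH -mulrnAl sA -mulrA -exprS.
Qed.

End UnipotentTorsion.

Section PathMatrices.
Local Open Scope ring_scope.
Variables (R : comUnitRingType) (w : syllables).
Local Notation k := (size w).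
Local Notation M := 'M[R]_k.+1.
Local Notation syl i := (nth (false, 0 : int) w i).

(** The adjacency matrix of the edges labelled b in a path whose i-th edge is
    labelled by the generator of the i-th syllable of w.  It is the variable of
    Magnus's power series ring, acting on the truncation of that ring to the
    monomials that are read along w. *)
Definition path_mx (b : bool) : M :=
  \matrix_(i, j) ((j == i.+1 :> nat) && ((syl i).1 == b))%:R.

Lemma path_mx_upper b : strictly_upper (path_mx b).
Proof. by move=> i j le_ji; rewrite mxE; case: eqP => // E; lia. Qed.

Hypothesis altw : alternating w.

(** Consecutive edges of the path have different labels. *)
Lemma path_mx_sqr b : path_mx b * path_mx b = 0.
Proof.
apply/matrixP=> i j; rewrite !mxE big1 // => l _; rewrite !mxE.
have [/andP[/eqP li /eqP bi]|_] := boolP (_ && _); last by rewrite mul0r.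
have [/andP[/eqP jl /eqP bl]|_] := boolP (_ && _); last by rewrite mulr0.
have ltk : (i.+1 < k)%N by move: (ltn_ord j); lia.
have /andP[/(sortedP (false, 0 : int))/(_ i ltk)] := altw.
by rewrite bi -li bl eqxx.
Qed.

Lemma path_mx_unit b : 1 + path_mx b \is a GRing.unit.
Proof.
apply/unitrP; exists (1 - path_mx b).
by rewrite !(mulrDl, mulrDr) !mulrN !mulNr path_mx_sqr oppr0 !mulr1 !mul1r !addr0 subrK addrK.
Qed.

Lemma path_mx_inv b : (1 + path_mx b)^-1 = 1 - path_mx b.
Proof.
apply: (mulrI (path_mx_unit b)); rewrite divrr ?path_mx_unit //.
by rewrite !(mulrDl, mulrDr) !mulrN path_mx_sqr oppr0 !mulr1 !mul1r !addr0 subrK.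
Qed.

End PathMatrices.

Section PathRep.
Variables (R : finComUnitRingType) (w : syllables).
Hypothesis altw : alternating w.
Local Notation k := (size w).
Local Notation U := {unit 'M[R]_k.+1}.
Local Notation syl i := (nth (false, 0%R : int) w i).

Definition path_rep : F2 -> U :=
  F2_lift (fun b => FinRing.unit 'M[R]_k.+1 (path_mx_unit R altw b)).
Lemma path_repM : {morph path_rep : u v / u * v}.
Proof. by move=> u v; rewrite /path_rep gmulfM. Qed.

Local Open Scope ring_scope.

Lemma path_rep_gen b : val (path_rep (gen b)) = 1 + path_mx R w b.
Proof. by rewrite /path_rep F2_lift_gen. Qed.

(** The square of the path matrix vanishes, so powers are linear in the exponent. *)
Lemma path_rep_zexpg b z :
  val (path_rep (zexpg (gen b) z)) = 1 + path_mx R w b *~ z.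
Proof.
set N := path_mx R w b; have NN : N * N = 0 := path_mx_sqr R altw b.
have Xn n : val (path_rep (gen b ^+ n)%g) = 1 + N *+ n.
  elim: n => [|n IH]; first by rewrite expg0 (morph_1 path_repM) mulr0n addr0.
  rewrite expgS path_repM /= IH path_rep_gen -/N mulrDl mul1r mulrDr mulr1.
  by rewrite mulrnAr NN mul0rn addr0 mulrSr addrA.
case: z => n; first exact: Xn.
rewrite [zexpg _ _]/(_^-1)%g (morph_V path_repM) /= Xn NegzE mulrNz.
have EV : (1 + N *+ n.+1) * (1 - N *+ n.+1) = 1.
  rewrite mulrDl !mulrDr !mulr1 mul1r mulrN mulrnAr mulrnAl NN !mul0rn oppr0.
  by rewrite addr0 subrK.
have U1 : 1 + N *+ n.+1 \is a GRing.unit by rewrite -Xn; exact: valP.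
by apply: (mulrI U1); rewrite divrr // EV.
Qed.

Lemma path_rep_upper u : strictly_upper (val (path_rep u) - 1).
Proof.
have step (A B : 'M[R]_k.+1) : strictly_upper (A - 1) -> strictly_upper (B - 1) ->
    strictly_upper (A * B - 1).
  have -> : A * B - 1 = (A - 1) * (B - 1) + (A - 1) + (B - 1).
    by rewrite mulrBl mul1r addrAC subrK mulrBr mulr1 addrA subrK.
  move=> uA uB i j le_ji; rewrite mxE [X in X + _]mxE.
  by rewrite strictly_upper_mul // uA // uB // !addr0.
elim/F2_ind: u => [|u b IH|u b IH].
- by rewrite (morph_1 path_repM) /= subrr => i j _; rewrite mxE.
- rewrite path_repM /=; apply: step => //; rewrite path_rep_gen addrC addKr.
  exact: path_mx_upper.
- rewrite path_repM (morph_V path_repM) /=; apply: step => //.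
  rewrite path_rep_gen path_mx_inv // addrC addKr => i j le_ji.
  by rewrite mxE path_mx_upper // oppr0.
Qed.

(** In the product over the syllables each factor advances by at most one edge;
    to get from one end of the path to the other, every factor has to advance. *)
Lemma path_rep_corner :
  val (path_rep (syllables_val w)) ord0 ord_max = (\prod_(a <- w) a.2)%:~R.
Proof.
suff P l : (l <= k)%N -> forall j : 'I_k.+1,
  val (path_rep (syllables_val (take l w))) ord0 j =
    if (j < l)%N then val (path_rep (syllables_val (take l w))) ord0 j
    else if j == l :> nat then (\prod_(a <- take l w) a.2)%:~R else 0.
  by have := P k (leqnn _) ord_max; rewrite ltnn eqxx take_size.
elim: l => [|l IH] lt_l j.
  rewrite take0 /syllables_val big_nil big_nil (morph_1 path_repM) /= mxE.
  by rewrite eq_sym -val_eqE /=; case: eqP.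
have [//|le_lj] := ltnP j l.+1.
rewrite (take_nth (false, 0 : int)) // -cats1.
rewrite {1}/syllables_val !big_cat !big_seq1 -/(syllables_val _) path_repM.
rewrite [LHS]/= path_rep_zexpg mulrDr mulr1 !mxE.
rewrite (IH (ltnW lt_l)) ltnNge (ltnW le_lj) /= (gtn_eqF le_lj) add0r.
set z := (syl l).2.
have entry i : (path_mx R w (syl l).1 *~ z) i j = z%:~R * path_mx R w (syl l).1 i j.
  by rewrite -scaler_int mxE.
have ltlk : (l < k.+1)%N by exact: ltnW.
rewrite (bigD1 (Ordinal ltlk)) //= big1 ?addr0; last first.
  move=> i; rewrite -val_eqE /= => il; rewrite (IH (ltnW lt_l)) (negbTE il) entry.
  have [lt_il|] := ltnP i l; last by rewrite mul0r.
  by rewrite mxE (_ : (j == i.+1 :> nat) = false) ?mulr0 //; apply/eqP; lia.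
rewrite (IH (ltnW lt_l)) /= ltnn eqxx entry mxE /= eqxx andbT.
by case: eqP => _; rewrite ?mulr1 ?mulr0 // rmorphM.
Qed.

End PathRep.

(** * Finite quotients of F2 of given exponent *)

(** Since i divides k! and i 'C(m, i) = m 'C(m - 1, i - 1), the product
    k! 'C(m, i) is a multiple of m. *)
Lemma dvdn_bin_fact m k i : 0 < i <= k -> (m %/ gcdn m k`! %| 'C(m, i))%N.
Proof.
move=> /andP[i0 lek]; set d := gcdn m k`!.
have d0 : 0 < d by rewrite gcdn_gt0 fact_gt0 orbT.
have dm : d %| m := dvdn_gcdl _ _.
have dk : d %| k`! := dvdn_gcdr _ _.
have cop : coprime (m %/ d) (k`! %/ d).
  by rewrite /coprime -(eqn_pmul2r d0) muln_gcdl !divnK // mul1n.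
rewrite -(Gauss_dvdr _ cop) -(dvdn_pmul2r d0) divnK // mulnAC divnK //.
have /dvdnP[q ->] : i %| k`! by apply: dvdn_fact; rewrite i0.
case: i i0 {lek} => // i _; rewrite -mulnA -mul_bin_diag mulnCA.
exact: dvdn_mulr.
Qed.

Lemma Zp_intr_eq0 M (z : int) : 1 < M -> (z%:~R == 0 :> 'Z_M)%R = (M %| `|z|)%N.
Proof.
move=> M1; have -> : (z%:~R == 0 :> 'Z_M)%R = (`|z|%N%:R == 0 :> 'Z_M)%R.
  by case: z => n //; rewrite NegzE mulrNz oppr_eq0.
by rewrite -val_eqE /= val_Zp_nat // /dvdn.
Qed.

(** The Magnus representation of a normal form of f, reduced modulo
    M = m / gcd(m, k!) with k the number of syllables: the exponent divides m by
    [dvdn_bin_fact], and if a power f ^ s became trivial, s ^ k times the nonzero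
    corner entry would be 0 modulo M, which fails once M is large. *)
Lemma finite_exponent_quotient (f : F2) (k : nat) : f <> 1 ->
  exists m0, forall m, m0 <= m -> exists (P : finGroupType) (h : F2 -> P),
    [/\ {morph h : u v / u * v}, forall u, h u ^+ m = 1 &
        forall s, 0 < s <= k -> h f ^+ s <> 1].
Proof.
move=> f1; have [w altw E] := normal_form f; subst f.
set z := (\prod_(a <- w) a.2)%R.
have w0 : 0 < size w by case: (w) f1 => //; rewrite /syllables_val big_nil.
(* With this bound, M exceeds s ^ size w * |z| for all s <= k. *)
exists ((size w)`! * (k ^ size w * `|z| + 2))%N => m lem.
set M := m %/ gcdn m (size w)`!.
have leM : k ^ size w * `|z| + 2 <= M.
  rewrite -(leq_pmul2l (fact_gt0 (size w))) (leq_trans lem) //.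
  have dm := dvdn_gcdl m (size w)`!.
  by rewrite -{1}(divnK dm) mulnC leq_mul // dvdn_leq ?fact_gt0 // dvdn_gcdr.
have M1 : 1 < M by rewrite (leq_trans _ leM) // addn2.
exists _, (path_rep 'Z_M altw); split=> [||s /andP[s0 sk] hs].
- exact: path_repM.
- move=> u; apply: val_inj; rewrite FinRing.val_unitX.
  rewrite -[val _](subrK 1%R) addrC; apply: unipotent_exponent.
    exact: path_rep_upper.
  move=> i ik; have := Zp_intr_eq0 (Posz 'C(m, i)) M1.
  by rewrite (dvdn_bin_fact m ik) => /eqP.
have := congr1 val hs; rewrite FinRing.val_unitX -[val _](subrK 1%R) addrC.
move=> /(unipotent_torsion (strictly_upper_pow (path_rep_upper 'Z_M altw _))).
move=> /matrixP/(_ ord0 ord_max); rewrite -scaler_nat !mxE path_rep_corner -/z.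
rewrite -val_eqE /= (ltn_eqF w0) mulr0n subr0 => /eqP.
rewrite -[(_ ^ _)%:R%R]/(((s ^ size w)%:Z)%:~R)%R -rmorphM Zp_intr_eq0 // abszM.
have z0 : 0 < `|z|.
  rewrite absz_gt0 prodf_seq_neq0; apply/allP => a aw.
  by have /andP[_ /allP] := altw; apply.
move=> /dvdn_leq; rewrite muln_gt0 expn_gt0 s0 /= z0 => /(_ isT).
apply/negP; rewrite -ltnNge (leq_trans _ leM) // addn2 ltnS ltnW // ltnS.
by rewrite leq_mul // leq_exp2r.
Qed.

Lemma finite_exponent_quotients (fs : seq F2) (k : nat) :
  (forall f, f \in fs -> f <> 1) ->
  exists m0, forall m, m0 <= m -> exists (P : finGroupType) (h : F2 -> P),
    [/\ {morph h : u v / u * v}, forall u, h u ^+ m = 1 &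
        forall f s, f \in fs -> 0 < s <= k -> h f ^+ s <> 1].
Proof.
elim: fs => [|f fs IH] fs1.
  exists 0 => m _; exists 'I_1, (fun=> ord0); split=> // [u v|u];
    by rewrite [LHS]ord1 [RHS]ord1.
have [m1 H1] := finite_exponent_quotient k (fs1 _ (mem_head _ _)).
have [|m2 H2] := IH; first by move=> h hfs; apply: fs1; rewrite inE hfs orbT.
exists (maxn m1 m2) => m; rewrite geq_max => /andP[/H1[P1 [h1 [M1 X1 N1]]]].
move=> /H2[P2 [h2 [M2 X2 N2]]].
exists (P1 * P2)%type, (fun u => (h1 u, h2 u)).
have hX u s : (h1 u, h2 u) ^+ s = (h1 u ^+ s, h2 u ^+ s).
  by elim: s => // s IHs; rewrite !expgS IHs.
split=> [u v|u|g s]; first by rewrite M1 M2.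
  by rewrite hX X1 X2.
rewrite hX inE => /orP[/eqP ->|gfs] sk [E1 E2]; first exact: (N1 s).
exact: (N2 g s).
Qed.

(** * Integral vectors off a rational subspace *)

Section LinearAlgebra.
Local Open Scope ring_scope.

Lemma clear_denominators (I : finType) (x : I -> rat) :
  exists2 d : int, d != 0 & exists e : I -> int, forall i, (e i)%:~R = d%:~R * x i.
Proof.
exists (\prod_i denq (x i)).
  by apply/prodf_neq0 => i _; exact: denq_neq0.
exists (fun i => (\prod_(j | j != i) denq (x j)) * numq (x i)) => i.
by rewrite [in RHS](bigD1 i) //= !intrM numqE; ring.
Qed.

(** The solutions of the system C have dimension at least #|I| - #|A|, which is
    more than the span of J can contain. *)
Lemma solution_off_subspace (I A B : finType) (C : A -> I -> rat) (J : B -> I -> rat) :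
  (#|A| + #|B| < #|I|)%N ->
  exists e : I -> int, (forall a, \sum_i C a i * (e i)%:~R = 0) /\
    ~ exists t : B -> rat, forall i, (e i)%:~R = \sum_b t b * J b i.
Proof.
move=> lt_AB.
pose Cm := \matrix_(i < #|I|, a < #|A|) C (enum_val a) (enum_val i).
pose Jm := \matrix_(b < #|B|, i < #|I|) J (enum_val b) (enum_val i).
have : ~~ (kermx Cm <= Jm)%MS.
  apply/negP => /mxrankS; rewrite mxrank_ker.
  by have := rank_leq_col Cm; have := rank_leq_row Jm; lia.
case/row_subPn => r nJ.
have [d d0 [e eE]] := clear_denominators (fun i => kermx Cm r (enum_rank i)).
have dQ : (d%:~R : rat) != 0 by rewrite intr_eq0.
exists e; split=> [a|[t tE]].
  have /matrixP/(_ r (enum_rank a)) := mulmx_ker Cm; rewrite !mxE => E.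
  rewrite (reindex (@enum_val I I)) /=; last first.
    by apply: onW_bij; exact: enum_val_bij.
  rewrite -[RHS](mulr0 d%:~R) -[X in _ = _ * X]E mulr_sumr; apply: eq_bigr => i _.
  by rewrite eE enum_valK !mxE enum_rankK mulrC mulrA.
case/negP: nJ; apply/submxP.
exists (\row_b (d%:~R^-1 * t (enum_val b))); apply/rowP=> i; rewrite [LHS]mxE [RHS]mxE.
apply: (mulfI dQ); rewrite -{1}(enum_valK i) -eE tE mulr_sumr.
rewrite (reindex (@enum_val B B)) /=; last by apply: onW_bij; exact: enum_val_bij.
by apply: eq_bigr => b _; rewrite !mxE mulrA mulVKf.
Qed.

End LinearAlgebra.

(** * Cocycles that kill prescribed powers *)

(** The minimal points of the orbits of f for some ordering of X represent the
    orbits, and their translates by f ^ 0, ..., f ^ k are pairwise distinct. *)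
Lemma orbit_representatives (G : groupType) (X : finType) (a : right_action G X) (x0 : X)
    (f : G) (m k : nat) :
  0 < m -> (forall x, a x (f ^+ m) = x) -> (forall x s, 0 < s <= k -> a x (f ^+ s) <> x) ->
  exists t : 'I_(#|X| %/ k.+1) -> X, forall x, exists s i, a x (f ^+ s) = t i.
Proof.
move=> m0 fm fk.
pose T := [set x | `[< forall s, enum_rank x <= enum_rank (a x (f ^+ s)) >]].
have cover x : exists s, a x (f ^+ s) \in T.
  pose O y := `[< exists s, y = a x (f ^+ s) >].
  have x1 : O x by apply/asboolP; exists 0; rewrite expg0 ract1.
  case: (arg_minnP (P := O) (fun y => enum_rank y : nat) x1) => y /asboolP[s ->] ymin.
  exists s; rewrite inE; apply/asboolP => r; apply: ymin.
  by apply/asboolP; exists (s + r); rewrite expgnDr ractM.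
have back t j : a (a t (f ^+ j)) (f ^+ (m.-1 * j)) = t.
  rewrite -ractM -expgnDr -mulSn prednK // expgnA.
  by elim: j => [|j IH]; rewrite ?expg0 ?ract1 // expgS ractM fm.
have le_fix t i j : a t (f ^+ i) = a t (f ^+ j) -> i <= j -> j <= k -> i = j.
  move=> E le_ij le_jk; apply/eqP; rewrite eqn_leq le_ij /= leqNgt; apply/negP => lt_ij.
  apply: (@fk (a t (f ^+ i)) (j - i)); first by rewrite subn_gt0 lt_ij; lia.
  by rewrite -ractM -expgnDr subnKC // -E.
have cardT : #|T| <= #|X| %/ k.+1.
  rewrite leq_divRL // (_ : (#|T| * k.+1)%N = #|finset.setX T [set: 'I_k.+1]|); last first.
    by rewrite finset.cardsX finset.cardsT card_ord.
  rewrite -(card_in_imset (f := fun p : X * 'I_k.+1 => a p.1 (f ^+ p.2))).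
    exact: max_card.
  move=> [t i] [t' j]; rewrite !inE !andbT => /asboolP Tt /asboolP Tt' /= E.
  have tt' : t = t'.
    apply: enum_rank_inj; apply/val_inj/eqP; rewrite eqn_leq /=; apply/andP; split.
      by rewrite -(back t' j) -E -ractM -expgnDr; exact: Tt.
    by rewrite -(back t i) E -ractM -expgnDr; exact: Tt'.
  rewrite -{}tt' in E *; congr pair; apply/val_inj => /=.
  have ik := ltn_ord i; have jk := ltn_ord j.
  by case: (leqP i j) => [ij|/ltnW ji]; [|apply/esym]; apply: (le_fix t).
exists (fun i => nth x0 (enum T) i) => x; have [s xs] := cover x.
have ltx : index (a x (f ^+ s)) (enum T) < #|X| %/ k.+1.
  by rewrite (leq_trans _ cardT) // cardE index_mem mem_enum.
by exists s, (Ordinal ltx); rewrite /= nth_index ?mem_enum.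
Qed.

Section Counting.
Variables (X : finType) (a : right_action F2 X) (x0 : X).
Variables (fs : seq F2) (m k : nat).
Hypothesis m_gt0 : 0 < m.
Hypothesis act_m : forall f x, f \in fs -> a x (f ^+ m) = x.
Hypothesis free_k : forall f x s, f \in fs -> 0 < s <= k -> a x (f ^+ s) <> x.
Local Open Scope ring_scope.

(** The vector c u x counts, with signs, how often the path u from x runs through
    each edge (b, y) of the Schreier graph.  Pairing it with edge weights gives all
    integral cocycles, and makes their values linear in the weights. *)
Lemma universal_cocycle : exists2 c : F2 -> X -> {ffun bool * X -> int},
  zcocycle a c & forall b x, c (gen b) x = [ffun i => (i == (b, x))%:R].
Proof.
pose B := multiplicative_copy {ffun bool * X -> int}.
have [c cM cE] := @F2_cocycle_exists X a B
  (fun b x => [ffun i => (i == (b, x))%:R : int] : {ffun bool * X -> int}).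
by exists c => // b x; rewrite cE.
Qed.

(** Evaluate E on f ^ s f ^ m = f ^ m f ^ s in two ways. *)
Lemma zcocycle_power_invariant (V : zmodType) (E : F2 -> X -> V) f :
  zcocycle a E -> f \in fs ->
  forall x s, E (f ^+ m)%g (a x (f ^+ s)%g) = E (f ^+ m)%g x.
Proof.
move=> EM ffs x s; apply: (addrI (E (f ^+ s)%g x)).
rewrite -(zcocycle_M EM) -expgnDr addnC expgnDr (zcocycle_M EM) act_m //.
by rewrite addrC.
Qed.

(** The unknowns are the weights of the 2 * #|X| edges.  By
    [zcocycle_power_invariant] it is enough that E (f ^ m) vanish at one point of
    each orbit of f; the support condition is one equation for each edge that
    starts outside Y. *)
Lemma cocycle_solution (Y : {set X}) (W : finType) (J : W -> bool * X -> rat) :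
  (size fs * (#|X| %/ k.+1) + 2 * #|~: Y| + #|W| < 2 * #|X|)%N ->
  exists E : F2 -> X -> int, [/\ zcocycle a E,
    forall b x, x \notin Y -> E (gen b) x = 0,
    forall f x, f \in fs -> E (f ^+ m)%g x = 0 &
    ~ exists t : W -> rat, forall b x,
        (E (gen b) x)%:~R = \sum_w t w * J w (b, x)].
Proof.
move=> count; have [c cM cE] := universal_cocycle.
have /choice[t tP] (j : 'I_(size fs)) : exists t : 'I_(#|X| %/ k.+1) -> X,
    forall x, exists s i, a x (nth 1%g fs j ^+ s)%g = t i.
  apply: (orbit_representatives x0 m_gt0) => [x|x s].
    by apply: act_m; rewrite mem_nth.
  by apply: free_k; rewrite mem_nth.
pose A : finType := (('I_(size fs) * 'I_(#|X| %/ k.+1)) + bool * {x | x \in ~: Y})%type.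
pose C (p : A) (i : bool * X) : rat := match p with
  | inl (j, l) => (c (nth 1%g fs j ^+ m)%g (t j l) i)%:~R
  | inr (b, y) => (i == (b, val y))%:R end.
have cardA : (#|A| + #|W| < #|{: bool * X}|)%N.
  by rewrite card_sum !card_prod !card_ord card_bool card_sig.
have [e [eC eJ]] := solution_off_subspace C J cardA.
pose E u x : int := \sum_i c u x i * e i.
have EM : zcocycle a E.
  apply: zcocycleI => u v x.
  rewrite /E -big_split; apply: eq_bigr => i _ /=.
  by rewrite (zcocycle_M cM) ffunE mulrDl.
have Egen b x : E (gen b) x = e (b, x).
  rewrite /E (bigD1 (b, x)) //= cE ffunE eqxx mul1r big1 ?addr0 // => i ne.
  by rewrite ffunE (negbTE ne) mul0r.
exists E; split=> // [b x xY|f x ffs|[s sE]].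
- have xY' : x \in ~: Y by rewrite inE.
  have := eC (inr (b, exist _ x xY')); rewrite (bigD1 (b, x)) //= eqxx mul1r.
  rewrite big1 ?addr0 => [/eqP|i ne]; last by rewrite (negbTE ne) mul0r.
  by rewrite intr_eq0 Egen => /eqP.
- have lt_f : (index f fs < size fs)%N by rewrite index_mem.
  have [s [l E0]] := tP (Ordinal lt_f) x; rewrite /= nth_index // in E0.
  rewrite -(zcocycle_power_invariant EM ffs x s) E0.
  apply/eqP; rewrite -(intr_eq0 rat); apply/eqP.
  rewrite -[RHS](eC (inl (Ordinal lt_f, l))) /E rmorph_sum; apply: eq_bigr => i _.
  by rewrite rmorphM /= nth_index.
- by apply: eJ; exists s => -[b x]; rewrite -Egen sE.
Qed.

End Counting.

(** * Heights and cyclic coverings *)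

Section Coinduction.
Variables (G : groupType) (X : Type) (a : right_action G X) (x0 : X).
Hypothesis tr : transitive_from a x0.
Variables (V : zmodType) (c : G -> X -> V).
Hypothesis cM : zcocycle a c.
Local Open Scope ring_scope.

(** The primitive b is the integral of c along chosen paths from x0. *)
Lemma zcocycle_inner : (forall u, a x0 u = x0 -> c u x0 = 0) ->
  exists b : X -> V, forall u x, c u x = b (a x u) - b x.
Proof.
move=> c0; have [w wE] := choice tr.
exists (fun x => c (w x) x0) => u x.
have wV y : a y (w y)^-1%g = x0 by rewrite -{1}(wE y) ractK.
have E : a x0 (w x * u * (w (a x u))^-1)%g = x0 by rewrite !ractM wE wV.
have := c0 _ E; rewrite !(zcocycle_M cM) wE (zcocycle_V cM) !ractM wE wV.
by move/eqP; rewrite subr_eq0 => /eqP <-; rewrite addrC addKr.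
Qed.

End Coinduction.

Lemma int_subgroup_generator (A : set int) : (exists2 z, A z & z != 0)%R ->
  (forall x y, A x -> A y -> A (x - y)%R) ->
  exists d, [/\ A d, d != 0%R & forall z, A z -> (d %| z)%Z].
Proof.
move=> [z Az z0] AB.
have A0 : A 0%R by rewrite -(subrr z); exact: AB.
have AN x : A x -> A (- x)%R by move=> Ax; rewrite -sub0r; exact: AB.
have AD x y : A x -> A y -> A (x + y)%R.
  by move=> Ax /AN Ay; rewrite -(opprK y); exact: AB.
have AM x (k : nat) : A x -> A (x *+ k)%R.
  by move=> Ax; elim: k => [|k IH]; rewrite ?mulr0n // mulrS; exact: AD.
have AMz x k : A x -> A (x *~ k)%R.
  by case: k => k Ax; rewrite ?NegzE ?mulrNz -?pmulrn; [|apply: AN]; exact: AM.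
have abs x : A x -> A (Posz `|x|%N).
  by move=> Ax; rewrite abszE; case: (ger0P x) => _ //; exact: AN.
have ex : exists n, `[< A (Posz n.+1) >].
  exists (`|z|.-1); apply/asboolP; rewrite prednK ?absz_gt0 //; exact: abs.
case: (ex_minnP ex) => n /asboolP An nmin.
exists n.+1; split=> // y Ay; apply/dvdz_mod0P/eqP/negPn/negP => r0.
have Ar : A (y %% n.+1)%Z.
  rewrite (_ : (y %% n.+1)%Z = y - Posz n.+1 *~ (y %/ n.+1)%Z)%R.
    by apply: AB => //; exact: AMz.
  by rewrite {2}(divz_eq y n.+1) -mulrzr mulrC intz addrC addKr.
have r_ge0 : (0 <= (y %% n.+1)%Z)%R by exact: modz_ge0.
have r_lt : ((y %% n.+1)%Z < n.+1)%R by exact: ltz_pmod.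
move: (y %% n.+1)%Z r0 Ar r_ge0 r_lt => [[|r]|] // _ Ar _ lt_r.
have := nmin r; rewrite (asboolT Ar) => /(_ isT); move: lt_r; lia.
Qed.

Section Height.
Variables (G : groupType) (X : Type) (a : right_action G X) (x0 : X).
Hypothesis tr : transitive_from a x0.
Variables (c : G -> X -> int).
Hypothesis cM : zcocycle a c.
Local Open Scope ring_scope.

(** Closing up each step x -> x u by fixed paths from x0 turns it into a loop at
    x0; the values of c on such loops are multiples of a single d, and c can be
    replaced by its values on the loops divided by d. *)
Lemma zcocycle_normalize : (exists2 u, a x0 u = x0 & c u x0 != 0) ->
  exists D : G -> X -> int, [/\ zcocycle a D,
    forall u, (forall x, a x u = x) -> (forall x, c u x = 0) -> forall x, D u x = 0 &
    exists2 l, a x0 l = x0 & D l x0 = 1].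
Proof.
move=> [u0 Su0 cu0].
pose A : set int := fun z => exists2 u, a x0 u = x0 & c u x0 = z.
have AB x y : A x -> A y -> A (x - y).
  move=> [u Su <-] [v Sv <-].
  have SV : a x0 v^-1%g = x0 by rewrite -{1}Sv ractK.
  exists (u * v^-1)%g; first by rewrite ractM Su.
  by rewrite (zcocycle_M cM) Su (zcocycle_V cM) SV.
have [|d [[u1 Su1 cu1] d0 dA]] := int_subgroup_generator _ AB.
  by exists (c u0 x0) => //; exists u0.
have [w wE] := choice tr.
have wV y : a y (w y)^-1%g = x0 by rewrite -{1}(wE y) ractK.
(* The loop at x0 attached to the step from x to a x u. *)
pose t u x := (w x * u * (w (a x u))^-1)%g.
have St u x : a x0 (t u x) = x0 by rewrite !ractM wE wV.
have dt u x : (d %| c (t u x) x0)%Z by apply: dA; exists (t u x).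
have tM u v x : t (u * v)%g x = (t u x * t v (a x u))%g.
  by rewrite /t ractM !mulgA mulgKV.
exists (fun u x => (c (t u x) x0 %/ d)%Z); split.
- apply: zcocycleI => u v x; apply: (mulIf d0).
  by rewrite mulrDl !divzK ?dt // tM (zcocycle_M cM) St.
- move=> u au cu x; rewrite /t !(zcocycle_M cM) ractM wE au cu (zcocycle_V cM) wV.
  by rewrite addr0 subrr div0z.
- exists u1 => //; rewrite /t Su1.
  have Sw : a x0 (w x0)^-1%g = x0 by exact: wV.
  rewrite !(zcocycle_M cM) !ractM wE Su1 (zcocycle_V cM) Sw addrAC subrr add0r.
  by rewrite cu1 divzz d0.
Qed.

End Height.

Section SkewProduct.
Variables (G : groupType) (X : Type) (a : right_action G X) (V : zmodType).
Variables (D : G -> X -> V) (DM : zcocycle a D).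
Local Open Scope ring_scope.

Let skew_fun (y : X * V) (u : G) : X * V := (a y.1 u, y.2 + D u y.1).

Let skew1 y : skew_fun y 1%g = y.
Proof. by case: y => x z; rewrite /skew_fun ract1 (zcocycle_1 DM) addr0. Qed.

Let skewM y u v : skew_fun y (u * v)%g = skew_fun (skew_fun y u) v.
Proof. by rewrite /skew_fun ractM (zcocycle_M DM) addrA. Qed.

(** The covering of X with group V on which c is the displacement. *)
Definition skew_product : right_action G (X * V) := RightAction skew1 skewM.

Lemma skewE x z u : skew_product (x, z) u = (a x u, z + D u x). Proof. by []. Qed.

End SkewProduct.

Section HeightCocycle.
Local Open Scope ring_scope.

(** A cocycle that is not a coboundary cannot vanish on the stabilizer of p0,
    and can then be normalized. *)
Lemma height_cocycle (P : finType) (a : right_action F2 P) (p0 : P) (fs : seq F2) (m : nat) :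
  transitive_from a p0 -> (0 < m)%N -> (forall f x, f \in fs -> a x (f ^+ m)%g = x) ->
  (forall f x s, f \in fs -> (0 < s <= size fs)%N -> a x (f ^+ s)%g <> x) ->
  exists D : F2 -> P -> int, [/\ zcocycle a D,
    forall f x, f \in fs -> D (f ^+ m)%g x = 0%R &
    exists2 l, a p0 l = p0 & D l p0 = 1%R].
Proof.
move=> tr m0 am free_k.
(* The vectors J span the values of coboundaries on the generators. *)
pose J (p : P) (i : bool * P) : rat := (p == a i.2 (gen i.1))%:R - (p == i.2)%:R.
have JE (t : P -> rat) b x : \sum_p t p * J p (b, x) = t (a x (gen b)) - t x.
  have pick y : \sum_p t p * (p == y)%:R = t y.
    rewrite (bigD1 y) //= eqxx mulr1 big1 ?addr0 // => p ne.
    by rewrite (negbTE ne) mulr0.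
  by under eq_bigr do rewrite mulrBr; rewrite sumrB !pick.
have [|E [EM _ Em nJ]] := cocycle_solution p0 m0 am free_k (Y := finset.setT) J.
  have : (0 < #|P|)%N by apply/card_gt0P; exists p0.
  have := leq_divM #|P| (size fs).+1.
  rewrite finset.setCT cards0 muln0 addn0 mulnC mulSn.
  case: (#|P| %/ _)%N => [|q]; nia.
have [|D [DM D0 Dl]] := zcocycle_normalize tr EM.
  apply: contrapT => nex; apply: nJ.
  have [|t tE] := zcocycle_inner tr EM.
    move=> u Su; apply/eqP/negPn/negP => cu; apply: nex; by exists u.
  by exists (fun p => (t p)%:~R) => b x; rewrite JE tE rmorphB.
exists D; split=> // f x ffs; apply: D0 => y; first exact: am.
exact: Em.
Qed.

End HeightCocycle.

(** * Exponent sums of commuting elements of F2 *)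

Section Exponents.
Local Open Scope ring_scope.

Definition exponent (b : bool) : F2 -> int :=
  F2_lift (fun b' => (b' == b)%:R : multiplicative_copy int).

Lemma exponentM b u v : exponent b (u * v)%g = exponent b u + exponent b v.
Proof. by rewrite /exponent gmulfM. Qed.

Lemma exponent1 b : exponent b 1%g = 0.
Proof. by rewrite /exponent gmulf1. Qed.

Lemma exponentV b u : exponent b u^-1%g = - exponent b u.
Proof. by rewrite /exponent gmulfV. Qed.

Lemma exponentJ b u v : exponent b (u ^ v)%g = exponent b u.
Proof. by rewrite /conjg !exponentM exponentV addrCA addNr addr0. Qed.

Lemma exponent_gen b b' : exponent b (gen b') = (b' == b)%:R.
Proof. by rewrite /exponent F2_lift_gen. Qed.

Lemma exponent_zexpg b u z : exponent b (zexpg u z) = exponent b u * z.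
Proof.
have En n : exponent b (u ^+ n)%g = exponent b u * Posz n.
  elim: n => [|n IH]; first by rewrite exponent1 mulr0.
  by rewrite expgS exponentM IH -add1n PoszD mulrDr mulr1.
by case: z => n; rewrite /= ?exponentV En // NegzE mulrN.
Qed.

Section Translation.
Variables (V : zmodType) (phi : F2 -> V).
Hypothesis phiM : forall u v, phi (u * v)%g = phi u + phi v.

Let phi1 : phi 1%g = 0.
Proof. by apply: (addrI (phi 1%g)); rewrite -phiM mulg1 addr0. Qed.

Let translate (z : V) (u : F2) : V := z + phi u.

Let translate1 z : translate z 1%g = z.
Proof. by rewrite /translate phi1 addr0. Qed.

Let translateM z u v : translate z (u * v)%g = translate (translate z u) v.
Proof. by rewrite /translate phiM addrA. Qed.

Definition translation : right_action F2 V := RightAction translate1 translateM.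

End Translation.

(** Let F2 act on Z/r through the exponent sum of the generator true, and let
    h u z count, with signs, the letters false that the path of u from z reads
    while it is at 0.  Since c and b
    commute, h c is invariant under translation by 1, hence constant; its sum
    over Z/r, the exponent sum of false in c, is then a multiple of r, for any r. *)
Lemma commuting_exponent (c b : F2) :
  exponent true c = 0 -> exponent true b = 1 -> (c * b = b * c)%g ->
  exponent false c = 0.
Proof.
(* The modulus is larger than the exponent sum that it will divide. *)
move=> c0 b1 cb; pose r := `|exponent false c|.+2; pose Z := 'Z_r.
pose phi u : Z := (exponent true u)%:~R.
have phiM u v : phi (u * v)%g = phi u + phi v by rewrite /phi exponentM rmorphD.
pose a := translation phiM.
have aE z u : a z u = z + phi u by [].
have [h hM hgen] := @F2_cocycle_exists _ a (multiplicative_copy int)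
  (fun b z => (~~ b && (z == 0))%:R : int).
have {}hM : zcocycle a (h : F2 -> Z -> int) := hM.
have shift_sum (f : Z -> int) u : \sum_z f (a z u) = \sum_z f z.
  by rewrite [RHS](reindex_inj (addIr (phi u))).
have hsum u : \sum_z (h u z : int) = exponent false u.
  have gsum e : \sum_z (h (gen e) z : int) = exponent false (gen e).
    rewrite exponent_gen hgen; case: e => /=; first by rewrite big1.
    by rewrite (bigD1 0) //= big1 ?addr0 // => z /negbTE ->.
  elim/F2_ind: u => [|u e IH|u e IH].
  - by rewrite exponent1 big1 // => z _; rewrite (zcocycle_1 hM).
  - under eq_bigr do rewrite (zcocycle_M hM).
    by rewrite big_split /= shift_sum IH exponentM gsum.
  - under eq_bigr do rewrite (zcocycle_M hM) (zcocycle_V hM).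
    rewrite big_split /= shift_sum IH exponentM exponentV sumrN; congr (- _ + _).
    by rewrite (shift_sum (h (gen e))) gsum.
have inv1 z : (h c (z + 1) : int) = h c z.
  have /(congr1 (fun u => h u z : int)) := cb; rewrite !(zcocycle_M hM) !aE.
  rewrite /phi c0 b1 addr0 [RHS]addrC => /addIr ->.
  by rewrite rmorph1.
have const z : (h c z : int) = h c 0.
  rewrite -[z]natr_Zp; elim: (nat_of_ord z) => [|n IH]; first by rewrite mulr0n.
  by rewrite -natr1 inv1.
have : exponent false c = h c 0 *+ r.
  rewrite -hsum; under eq_bigr do rewrite const.
  by rewrite sumr_const card_ord.
rewrite -mulr_natr natz => E.
have := congr1 absz E; rewrite abszM /= /r.
move: (absz (h c _)) => [|q]; last by rewrite mulSn; lia.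
by rewrite mul0n => /eqP; rewrite absz_eq0 => /eqP.
Qed.

Lemma commuting_exponents (x y : F2) :
  exponent true y = 1 -> (x * y = y * x)%g ->
  exponent false x = exponent true x * exponent false y.
Proof.
move=> y1 xy; set q := exponent true x.
have := @commuting_exponent (x * zexpg y (- q))%g y.
rewrite !exponentM !exponent_zexpg y1 mul1r subrr => /(_ erefl erefl) H.
apply/eqP; rewrite mulrC -subr_eq0 -mulrN; apply/eqP; apply: H.
rewrite -mulgA [RHS]mulgA -xy -mulgA; congr (_ * _)%g.
rewrite zexpgN; apply/esym/commuteV; rewrite /commute.
by case: (q) => r /=; [|apply: commuteV]; apply: commuteX.
Qed.

End Exponents.

(** * Transitive actions and local evaluation of cocycles *)

(** The image of F2 in a finite quotient, acted upon by right translations. *)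
Lemma finite_transitive_action (fs : seq F2) (k : nat) :
  (forall f, f \in fs -> f <> 1) ->
  exists m0, forall m, m0 <= m ->
    exists (P : finType) (a : right_action F2 P) (p0 : P),
    [/\ transitive_from a p0, forall u x, a x (u ^+ m) = x &
        forall f x s, f \in fs -> 0 < s <= k -> a x (f ^+ s) <> x].
Proof.
move=> /(finite_exponent_quotients k)[m0 H]; exists m0 => m /H[Q [h [hM hm hk]]].
pose I : {set Q} := [set q | `[< exists u, h u = q >]].
have IP q : reflect (exists u, h u = q) (q \in I) by rewrite inE; exact: asboolP.
have IM (q : {q | q \in I}) u : val q * h u \in I.
  by case: q => q /= /IP[v <-]; apply/IP; exists (v * u); rewrite hM.
pose act (q : {q | q \in I}) u : {q | q \in I} := @exist Q (fun p => p \in I) (val q * h u) (IM q u).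
have act1 q : act q 1 = q by apply: val_inj; rewrite /= (morph_1 hM) mulg1.
have actM q u v : act q (u * v) = act (act q u) v.
  by apply: val_inj; rewrite /= hM mulgA.
have I1 : 1 \in I by apply/IP; exists 1; exact: morph_1.
exists {q | q \in I}, (RightAction act1 actM), (@exist Q (fun p => p \in I) 1 I1); split.
- move=> [q qI]; have /IP[u hu] := qI.
  by exists u; apply: val_inj; rewrite /= mul1g.
- by move=> u x; apply: val_inj; rewrite /= (morph_X hM) hm mulg1.
- move=> f x s ffs sk /(congr1 val) /=; rewrite (morph_X hM) => /eqP.
  by rewrite -[X in _ == X]mulg1 (inj_eq (mulgI _)) => /eqP; exact: hk.
Qed.

Section LocalEvaluation.
Variables (P : finType) (a : right_action F2 P) (D : F2 -> P -> int).
Variable (DM : zcocycle a D).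
Local Notation S := (skew_product DM).

(** The path of u stays within a distance N of its starting level, and N depends
    only on u and on the heights of the generators.  If on that part of the
    covering all values of c are powers of one and the same B, then the value of c
    on the path is a power of B too. *)
Lemma local_evaluation u : exists N : nat,
  forall (c : F2 -> P * int -> F2) (E : F2 -> P * int -> int) (B : F2) (x : P * int),
  cocycle S c -> zcocycle S E ->
  (forall b (y : P * int), `|(y.2 - x.2)%R|%N <= N -> c (gen b) y = zexpg B (E (gen b) y)) ->
  c u x = zexpg B (E u x).
Proof.
(* K bounds the change of level along one edge. *)
pose K : nat := \sum_(i : bool * P) `|D (gen i.1) i.2|%N.
have DK b p : `|D (gen b) p|%N <= K.
  by rewrite /K (bigD1 (b, p)) //= leq_addr.
elim/F2_ind: u => [|u b [N IH]|u b [N IH]].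
- exists 0 => c E B x cM EM _.
  by rewrite (cocycle_1 cM) (zcocycle_1 EM).
- exists (N + K) => c E B [p z] cM EM cE.
  rewrite cM (zcocycle_M EM) zexpgD cE /= ?subrr //; congr (_ * _).
  apply: IH => // e y; rewrite /= => lt_y; apply: cE => /=.
  by have := DK b p; lia.
- exists (N + K) => c E B [p z] cM EM cE.
  rewrite cM (zcocycle_M EM) zexpgD (cocycle_V cM) (zcocycle_V EM) zexpgN.
  have DV : D (gen b)^-1 p = (- D (gen b) (a p (gen b)^-1%g))%R by rewrite (zcocycle_V DM).
  have := DK b (a p (gen b)^-1) => DKp.
  rewrite skewE DV cE /=; last by lia.
  congr (_ * _); apply: IH => // e y; rewrite /= => lt_y; apply: cE => /=; lia.
Qed.

End LocalEvaluation.

(** * Monodromy of a cyclic covering *)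

Lemma Zp_intr_modz n (z : int) : 1 < n ->
  (nat_of_ord (z%:~R : 'Z_n)%R : int) = (z %% n)%Z.
Proof.
move=> n1; have n0 : (n%:R = 0 :> 'Z_n)%R by rewrite pchar_Zp.
have -> : (z%:~R = (z %% n)%Z%:~R :> 'Z_n)%R.
  rewrite {1}(divz_eq z n) rmorphD rmorphM /=.
  by rewrite (_ : (n%:~R)%R = 0%R) ?mulr0 ?add0r.
have nz : (n%:Z != 0)%R by lia.
have := modz_ge0 z nz; have : ((z %% n)%Z < n)%R by apply: ltz_pmod; lia.
case: (z %% n)%Z => // r lt_r _.
by rewrite -pmulrn val_Zp_nat // modn_small.
Qed.

Section Monodromy.
Variables (P : finType) (a : right_action F2 P) (D : F2 -> P -> int).
Variable (DM : zcocycle a D).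
Variables (n w : nat).
Hypothesis n_gt1 : 1 < n.

Definition height_mod (u : F2) (p : P) : 'Z_n := ((D u p)%:~R)%R.

Lemma height_modM : zcocycle a height_mod.
Proof. by apply: zcocycleI => u v p; rewrite /height_mod (zcocycle_M DM) rmorphD. Qed.

Variable E : F2 -> P * 'Z_n -> int.
Hypothesis EM : zcocycle (skew_product height_modM) E.
Hypothesis E_supp : forall b (p : P) (z : 'Z_n),
  ~~ (w <= z < n - w) -> E (gen b) (p, z) = 0%R.

Local Notation act := (skew_product DM).

(** The pull-back of E to the infinite covering P x Z. *)
Definition lamps (u : F2) (x : P * int) : int := E u (x.1, (x.2)%:~R%R).

Lemma lampsM : zcocycle act lamps.
Proof.
apply: zcocycleI => u v [p z]; rewrite /lamps (zcocycle_M EM) !skewE /=.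
by rewrite rmorphD.
Qed.

(** The generator A = gen false conjugated so as to mark the q-th interval of
    length n, where T = gen true stands for the passage to the next interval. *)
Definition shifted_letter (q : int) : F2 := gen false ^ zexpg (gen true) (- q)%R.

Lemma monodromy_exists : exists2 c : F2 -> P * int -> F2, cocycle act c &
  forall b x, c (gen b) x = zexpg (shifted_letter (x.2 %/ n)%Z) (lamps (gen b) x).
Proof.
have [c cM cE] := @F2_cocycle_exists _ act _
  (fun b x => zexpg (shifted_letter (x.2 %/ n)%Z) (lamps (gen b) x)).
by exists c => // b x; rewrite cE.
Qed.

Variable c : F2 -> P * int -> F2.
Hypothesis cM : cocycle act c.
Hypothesis cE : forall b x,
  c (gen b) x = zexpg (shifted_letter (x.2 %/ n)%Z) (lamps (gen b) x).

(** An edge with nonzero label starts more than w levels away from all other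
    intervals; so, if it is within w of the starting level of u, it lies over the
    same interval as that level. *)
Lemma monodromy_local u x N :
  (forall (c : F2 -> P * int -> F2) (E : F2 -> P * int -> int) (B : F2) (x : P * int),
    cocycle act c -> zcocycle act E ->
    (forall b (y : P * int), `|(y.2 - x.2)%R|%N <= N ->
      c (gen b) y = zexpg B (E (gen b) y)) ->
    c u x = zexpg B (E u x)) ->
  N <= w -> c u x = zexpg (shifted_letter (x.2 %/ n)%Z) (lamps u x).
Proof.
move=> uN le_Nw; apply: uN => //; first exact: lampsM.
move=> b [p' z'] /= le_z; rewrite cE /=.
set q' := (z' %/ n)%Z; set q := (x.2 %/ n)%Z.
have [->//|qq'] := eqVneq q' q.
rewrite (_ : lamps _ _ = 0%R) //; apply: E_supp.
have n0 : (n%:Z != 0)%R by lia.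
have n_gt0 : (0 < n%:Z)%R by lia.
have := Zp_intr_modz z' n_gt1.
have := modz_ge0 z' n0; have := ltz_pmod z' n_gt0.
have := modz_ge0 x.2 n0; have := ltz_pmod x.2 n_gt0.
have := divz_eq z' n; have := divz_eq x.2 n; rewrite -/q -/q'.
move: (z' %% n)%Z (x.2 %% n)%Z => r' r E1 E2 r1 r2 r1' r2' val_r'.
apply/negP; rewrite /= => /andP[w1 w2].
have [lt_q|lt_q] : (q + 1 <= q')%R \/ (q' + 1 <= q)%R by lia.
  have := lt_q; rewrite -(ler_pM2r n_gt0) mulrDl mul1r; lia.
have := lt_q; rewrite -(ler_pM2r n_gt0) mulrDl mul1r; lia.
Qed.

(** Moving up by q intervals conjugates all labels by the same power of T. *)
Lemma monodromy_shift u (p : P) (z q : int) :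
  c u (p, (z + q * n)%R) = c u (p, z) ^ zexpg (gen true) (- q)%R.
Proof.
pose d u (x : P * int) := c u (x.1, (x.2 + q * n)%R) ^ zexpg (gen true) q.
suff E' : d u (p, z) = c u (p, z) by rewrite -E' /d /= zexpgN conjgK.
have dM : cocycle act d.
  move=> {}u v [p' z'] /=; rewrite /d cM conjMg !skewE /=.
  by rewrite addrAC.
apply: (F2_cocycle_ext dM cM) => b [p' z']; rewrite /d !cE /=.
have n0 : (n%:Z != 0)%R by lia.
rewrite [(z' + _)%R]addrC divzMDl // -zexpgJ /shifted_letter -conjgM -zexpgD.
rewrite (_ : (- (q + (z' %/ n)%Z) + q = - (z' %/ n)%Z)%R); last by lia.
rewrite /lamps /= rmorphD rmorphM /=.
by rewrite (_ : (n%:~R)%R = 0%R) ?mulr0 ?add0r // -pmulrn pchar_Zp.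
Qed.

(** Forgetting T, a path collects the sum of the exponents on its edges. *)
Lemma monodromy_exponent_false u x : exponent false (c u x) = lamps u x.
Proof.
apply: (F2_cocycle_ext (a := act) (B := multiplicative_copy int)
  (c := fun u x => exponent false (c u x)) (d := lamps)).
- by apply: zcocycleI => {}u v {}x; rewrite cM exponentM.
- exact: lampsM.
- by move=> b {}x; rewrite cE exponent_zexpg exponentJ exponent_gen mul1r.
Qed.

Lemma monodromy_exponent_true u x : exponent true (c u x) = 0%R.
Proof.
apply: (F2_cocycle_ext (a := act) (B := multiplicative_copy int)
  (c := fun u x => exponent true (c u x)) (d := fun u x => 0%R)).
- by apply: zcocycleI => {}u v {}x; rewrite cM exponentM.
- by apply: zcocycleI => {}u v {}x; rewrite addr0.
- by move=> b {}x; rewrite cE exponent_zexpg exponentJ exponent_gen mul0r.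
Qed.

End Monodromy.

(** * Non-commutativity of the monodromy *)

(** Elements with the same image under c lie in the same coset, so that the
    cosets are an image of the range of c. *)
Lemma finite_index_by (G : groupType) (K : set G) (T : Type) (c : G -> T) :
  is_subgroup K -> finite_set (range c) ->
  (forall x y, c x = c y -> K (x^-1 * y)) -> finite_index K.
Proof.
move=> sK fc cK; have [_ KM KV] := sK; split=> //.
pose h (t : T) : set G := fun z => exists2 x, c x = t & lcoset_set K x z.
suff -> : lcoset_space K = (h @` range c)%classic by exact: finite_image.
have hE x : h (c x) = lcoset_set K x.
  apply/seteqP; split=> [z [y cy [k Kk <-]]|z zx]; last by exists x.
  exists (x^-1 * y * k); first by apply: KM => //; apply: cK.
  by rewrite -mulgA mulKVg.
apply/seteqP; split=> [_ [x _ <-]|_ [_ [x _ <-] <-]].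
  by exists (c x) => //; exists x.
by exists x => //; rewrite hE.
Qed.

Section Noncommuting.
Variables (P : finType) (a : right_action F2 P) (p0 : P) (D : F2 -> P -> int).
Variable (DM : zcocycle a D).
Variables (n : nat).
Hypothesis n_gt1 : 1 < n.
Variable E : F2 -> P * 'Z_n -> int.
Local Notation actn := (skew_product (height_modM DM n)).
Local Notation act := (skew_product DM).
Variable c : F2 -> P * int -> F2.
Hypothesis cM : cocycle act c.
Hypothesis cE : forall b x,
  c (gen b) x = zexpg (shifted_letter (x.2 %/ n)%Z) (lamps E (gen b) x).

Local Notation x0 := (p0, 0%R : 'Z_n).
Local Notation S := (stab actn x0).

(** These vectors span the combinations of coboundaries and of the height. *)
Definition excluded (o : option (P * 'Z_n)) (i : bool * (P * 'Z_n)) : rat :=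
  match o with
  | Some y => ((y == actn i.2 (gen i.1))%:R - (y == i.2)%:R)%R
  | None => ((D (gen i.1) i.2.1)%:~R)%R
  end.

(** The power of T counts the passages from one interval to the next, and makes
    the map multiplicative on the stabilizer of (p0, 0) in P x Z/n: a loop there
    lifts to a path of the infinite covering that ends q intervals higher. *)
Definition monodromy (u : F2) : F2 :=
  c u (p0, 0%R) * zexpg (gen true) (D u p0 %/ n)%Z.

Lemma stab_height u : S u -> a p0 u = p0 /\ (n %| D u p0)%Z.
Proof.
move=> Su; split; first exact: (congr1 fst Su).
rewrite dvdzE -Zp_intr_eq0 // -[_%:~R%R]add0r; apply/eqP; exact: (congr1 snd Su).
Qed.

Lemma monodromyM : {in S &, {morph monodromy : u v / u * v}}.
Proof.
move=> u v /set_mem/stab_height[pu Du] /set_mem/stab_height[pv Dv].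
have n0 : (n%:Z != 0)%R by lia.
rewrite /monodromy cM (zcocycle_M DM) skewE pu add0r divzDl // zexpgD.
have -> : (p0, D u p0) = (p0, (0 + (D u p0 %/ n)%Z * n)%R).
  by rewrite add0r divzK.
rewrite (monodromy_shift n_gt1 cM cE) zexpgN /conjg invgK !mulgA.
by rewrite -!mulgA mulKg.
Qed.

Hypothesis tr : transitive_from a p0.
Variable l : F2.
Hypotheses (l_stab : a p0 l = p0) (l_height : D l p0 = 1%R).

Lemma skew_mod_transitive : transitive_from actn x0.
Proof.
move=> [p z]; have [u pu] := tr p.
pose k := nat_of_ord (z - (D u p0)%:~R)%R.
exists (l ^+ k * u); rewrite ractM /= (ract_fixX _ l_stab) pu.
congr pair; rewrite /height_mod (zcocycle_stabX DM) // l_height add0r.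
by rewrite natz -pmulrn natr_Zp subrK.
Qed.

Hypothesis EM : zcocycle actn E.

(** Let u be a loop of height exactly n, so that its monodromy has exponent 1 in
    T.  If all the monodromies commute, [commuting_exponents] shows that E v is
    determined by the height of v for all v in the stabilizer: E is there a
    multiple of D.  The difference of E and this multiple of D vanishes on the
    stabilizer, hence is a coboundary. *)
Lemma monodromy_noncommuting :
  (~ exists t : option (P * 'Z_n) -> rat, forall b x,
      ((E (gen b) x)%:~R = \sum_o t o * excluded o (b, x))%R) ->
  exists u v, [/\ S u, S v & monodromy u * monodromy v <> monodromy v * monodromy u].
Proof.
move=> nE; apply: contrapT => com; apply: nE.
have {}com u v : S u -> S v -> monodromy u * monodromy v = monodromy v * monodromy u.
  by move=> Su Sv; apply: contrapT => ncom; apply: com; exists u, v.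
have n0 : (n%:Z != 0)%R by lia.
pose u := l ^+ n.
have Du : D u p0 = n by rewrite (zcocycle_stabX DM) // l_height natz.
have Su : S u.
  rewrite /stab /= (ract_fixX _ l_stab) /height_mod Du.
  by rewrite -pmulrn pchar_Zp // addr0.
(* On the stabilizer, E is D multiplied by e / n. *)
pose e := E u x0.
have key v : S v -> (E v x0 * n = D v p0 * e)%R.
  move=> Sv; have [pv Dv] := stab_height Sv; set q := (D v p0 %/ n)%Z.
  have expf w : exponent false (monodromy w) = E w x0.
    rewrite /monodromy exponentM exponent_zexpg exponent_gen mul0r addr0.
    exact: (monodromy_exponent_false EM cM cE).
  have expt w : exponent true (monodromy w) = (D w p0 %/ n)%Z.
    rewrite /monodromy exponentM exponent_zexpg exponent_gen mul1r.
    by rewrite (monodromy_exponent_true cM cE) add0r.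
  have nn1 : (n %/ n)%Z = 1%R by rewrite divzz n0.
  have := @commuting_exponents (monodromy v) (monodromy u).
  rewrite !expf !expt Du nn1 -/q => /(_ erefl (com _ _ Sv Su)) ->.
  by rewrite -/e mulrAC divzK.
pose F (w : F2) (x : P * 'Z_n) : int := (E w x * n - D w x.1 * e)%R.
have FM : zcocycle actn F.
  apply: zcocycleI => w w' [p z]; rewrite /F (zcocycle_M EM) (zcocycle_M DM) skewE /=.
  by rewrite mulrDl mulrDl; lia.
have [b bE] : exists b : P * 'Z_n -> int, forall w x, F w x = (b (actn x w) - b x)%R.
  apply: (zcocycle_inner skew_mod_transitive FM) => w Sw.
  by rewrite /F key // subrr.
exists (fun o => match o with
  | Some y => (b y)%:~R / n%:R | None => e%:~R / n%:R end)%R => s x.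
have pick y : (\sum_(p : P * 'Z_n) (b p)%:~R / n%:R * (p == y)%:R = (b y)%:~R / n%:R :> rat)%R.
  rewrite (bigD1 y) //= eqxx mulr1 big1 ?addr0 // => p ne.
  by rewrite (negbTE ne) mulr0.
rewrite (bigD1 None) //= (reindex_omap Some id) /=; last by case.
under eq_bigr do rewrite mulrBr.
rewrite (eq_bigl xpredT); last by move=> y; rewrite eqxx.
rewrite sumrB !pick.
have nQ : (n%:R != 0 :> rat)%R by rewrite pnatr_eq0; lia.
have := congr1 (fun z : int => z%:~R : rat)%R (bE (gen s) x).
rewrite /F !rmorphB !rmorphM /= -pmulrn => H.
apply: (mulIf nQ); rewrite !mulrDl mulNr !divfK // mulrAC divfK //.
by rewrite -H mulrC; ring.
Qed.

End Noncommuting.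

(** * Quotients of F2 by large powers *)

Lemma card_window n w :
  #|[set z : 'I_n | ~~ (w <= z < n - w)]| <= (2 * w)%N.
Proof.
set A := [set _ | _].
have -> : (2 * w)%N = size (iota 0 w ++ iota (n - w) w).
  by rewrite size_cat !size_iota addnn mul2n.
rewrite cardE -(size_map val); apply: uniq_leq_size.
  by rewrite (map_inj_uniq val_inj) enum_uniq.
move=> _ /mapP[z zA ->]; move: zA; rewrite mem_enum inE mem_cat !mem_iota.
by have := ltn_ord z; rewrite /=; move: (nat_of_ord z) => i; lia.
Qed.

(** The inequality required by [cocycle_solution] on P x Z/n, with p points in P,
    2 * w forbidden levels, and p * n + 1 dimensions for the excluded vectors. *)
Lemma window_count (k p n w : nat) : 0 < p -> n = (k.+1 * (4 * w + 2))%N ->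
  (k * ((p * n) %/ k.+1) + 2 * (p * (2 * w)) + (p * n).+1 < 2 * (p * n))%N.
Proof.
move=> p0 ->; rewrite [(k.+1 * _)%N]mulnC mulnA mulnK //.
by move: p0; case: p => // p _; rewrite !mulnS; nia.
Qed.

(** The map chi induces on S / N a homomorphism whose values do not all commute;
    hence F2 modulo the m-th powers of fs is large.  The data are kept on F2 in
    order to be pulled back along a map onto F2. *)
Definition large_mod_powers (fs : seq F2) (m : nat) : Prop :=
  exists (S N : set F2) (chi : F2 -> F2),
  [/\ finite_index S, {in S &, {morph chi : u v / u * v}},
      exists u v, [/\ S u, S v & chi u * chi v <> chi v * chi u],
      is_normal_subgroup N &
      [/\ (forall u, N u -> S u), (forall u, N u -> chi u = 1) &
          forall f, f \in fs -> N (f ^+ m)]].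

Section MonodromyQuotient.
Variables (P : finType) (a : right_action F2 P) (p0 : P) (fs : seq F2) (m : nat).
Hypothesis tr : transitive_from a p0.
Hypothesis m_gt0 : 0 < m.
Hypothesis act_m : forall u x, a x (u ^+ m) = x.
Hypothesis free_k : forall f x s, f \in fs -> 0 < s <= size fs -> a x (f ^+ s) <> x.

Lemma monodromy_quotient : large_mod_powers fs m.
Proof.
have [D [DM Dm [l l_stab l_height]]] :=
  height_cocycle tr m_gt0 (fun f x _ => act_m f x) free_k.
have [w wP] : exists w, forall f, f \in fs -> exists2 N : nat, N <= w &
    forall (c : F2 -> P * int -> F2) (E : F2 -> P * int -> int) (B : F2) (x : P * int),
    cocycle (skew_product DM) c -> zcocycle (skew_product DM) E ->
    (forall b (y : P * int), `|(y.2 - x.2)%R|%N <= N ->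
      c (gen b) y = zexpg B (E (gen b) y)) ->
    c (f ^+ m) x = zexpg B (E (f ^+ m) x).
  have [N NP] := choice (local_evaluation DM).
  exists (\max_(f <- fs) N (f ^+ m)) => f ffs.
  exists (N (f ^+ m)); first exact: leq_bigmax_seq.
  exact: NP.
(* The factor (size fs).+1 makes the division in window_count exact. *)
pose n := ((size fs).+1 * (4 * w + 2))%N.
have n_gt1 : 1 < n by rewrite /n; lia.
pose an := skew_product (height_modM DM n).
have an_m f x : f \in fs -> an x (f ^+ m) = x.
  by move=> ffs; case: x => p z; rewrite /= act_m /height_mod Dm // addr0.
have an_free f x s : f \in fs -> 0 < s <= size fs -> an x (f ^+ s) <> x.
  by move=> ffs sk /(congr1 fst); exact: free_k.
pose Y : {set P * 'Z_n} := [set x : P * 'Z_n | w <= x.2 < n - w].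
have cardX : #|{: P * 'Z_n}| = (#|P| * n)%N.
  by rewrite card_prod card_ord Zp_cast.
have cardY : #|~: Y| <= (#|P| * (2 * w))%N.
  pose Z : {set 'Z_n} := [set z : 'Z_n | ~~ (w <= z < n - w)].
  have -> : ~: Y = finset.setX finset.setT Z by apply/setP=> -[p z]; rewrite !inE.
  rewrite finset.cardsX finset.cardsT leq_mul2l; apply/orP; right.
  have EZ : (Zp_trunc n).+2 = n by rewrite Zp_cast.
  apply: leq_trans (card_window _ w); apply/eq_leq/eq_card => z; rewrite !inE.
  by congr (~~ (_ && (_ < _ - w))); rewrite EZ.
have P_gt0 : 0 < #|P| by apply/card_gt0P; exists p0.
have [|E [EM E_supp Em E_new]] :=
  cocycle_solution (p0, 0%R : 'Z_n) m_gt0 an_m an_free (Y := Y) (excluded DM (n := n)).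
  rewrite card_option cardX.
  have wc := window_count P_gt0 (erefl n : n = ((size fs).+1 * (4 * w + 2))%N).
  apply: leq_ltn_trans wc.
  by rewrite leq_add2r leq_add2l leq_mul2l cardY.
have {}E_supp b (p : P) (z : 'Z_n) : ~~ (w <= z < n - w) -> E (gen b) (p, z) = 0%R.
  by move=> zw; apply: E_supp; rewrite inE.
have [c cM cE] := monodromy_exists DM E.
have [u [v [Su Sv uv]]] := monodromy_noncommuting n_gt1 cM cE tr l_stab l_height EM E_new.
pose S := stab an (p0, 0%R : 'Z_n).
pose act := skew_product DM.
(* The elements whose path from every point is closed and collects nothing. *)
pose N : set F2 := fun y => (forall x, act x y = x) /\ (forall x, c y x = 1).
have D0 y p : N y -> D y p = 0%R.
  by move=> [/(_ (p, 0%R))/(congr1 snd) /= + _]; rewrite add0r.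
exists S, N, (monodromy p0 D n c); split.
- apply: (@finite_index_by _ _ (P * 'Z_n)%type (fun y => an (p0, 0%R) y^-1)).
  + exact: stab_subgroup.
  + exact: finite_finset.
  + move=> x y E'; change (an (p0, 0%R) (x^-1 * y) = (p0, 0%R)).
    by rewrite ractM E' ractKV.
- exact: (monodromyM n_gt1 cM cE).
- by exists u, v.
- split; first split.
  + by split=> x; rewrite ?ract1 ?(cocycle_1 cM).
  + move=> x y [ax cx] [ay cy]; split=> z; first by rewrite ractM ax ay.
    by rewrite cM cx cy mul1g.
  + move=> x [ax cx]; split=> z; first by rewrite -{1}(ax z) ractK.
    by rewrite (cocycle_V cM) cx invg1.
  + move=> x y [ax cx]; split=> z.
      by rewrite /conjg !ractM ax ractKV.
    by rewrite (cocycle_conj cM) ?ax // cx conj1g.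
- split=> [y Ny|y Ny|f ffs].
  + have [ay _] := Ny; rewrite /S /stab /= /height_mod D0 // add0r.
    by congr pair; exact: (congr1 fst (ay (p0, 0%R))).
  + by have [_ cy] := Ny; rewrite /monodromy cy D0 // div0z mulg1.
  + have Nf x : act x (f ^+ m) = x.
      by case: x => p z; rewrite /= act_m Dm // addr0.
    split=> // x; have [M le_M fP] := wP _ ffs.
    rewrite (monodromy_local n_gt1 EM E_supp cM cE x fP le_M).
    by rewrite /lamps Em.
Qed.
End MonodromyQuotient.

Lemma free_power_quotient (fs : seq F2) :
  exists m0, forall m, m0 <= m -> large_mod_powers fs m.
Proof.
pose gs := [seq f <- fs | f != 1].
have [|m0 H] := @finite_transitive_action gs (size gs).
  by move=> f; rewrite mem_filter => /andP[/eqP].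
exists m0.+1 => m lt_m; have [P [a [p0 [tr am free_k]]]] := H m (ltnW lt_m).
have m_gt0 : 0 < m by exact: leq_trans lt_m.
have [S [N [chi [fS chiM ncom nN [NS N1 Nf]]]]] :=
  monodromy_quotient tr m_gt0 am free_k.
exists S, N, chi; split=> //; split=> // f ffs.
have [->|f1] := eqVneq f 1; first by rewrite expg1n; case: nN => -[].
by apply: Nf; rewrite mem_filter f1.
Qed.

(** * The Nielsen-Schreier theorem for F2 *)

Section SubgroupType.
Variables (G : groupType) (H : set G).

Definition subgroup_type (sH : is_subgroup H) : Type := {x : G | H x}.

Variable sH : is_subgroup H.
Local Notation T := (subgroup_type sH).

Definition sub_val (s : T) : G := proj1_sig s.

Lemma sub_valP (s : T) : H (sub_val s). Proof. exact: (proj2_sig s). Qed.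

Lemma sub_val_inj : injective sub_val.
Proof. by move=> [x Hx] [y Hy] /= E; exact: eq_exist. Qed.

HB.instance Definition _ := gen_eqMixin T.
HB.instance Definition _ := gen_choiceMixin T.

Definition sub_elt x (Hx : H x) : T := exist _ x Hx.

Let H1 : H 1. Proof. by case: sH. Qed.
Let HM x y : H x -> H y -> H (x * y). Proof. by case: sH => _ + _; apply. Qed.
Let HV x : H x -> H x^-1. Proof. by case: sH => _ _; apply. Qed.

Definition sub_one : T := sub_elt H1.
Definition sub_mul (s t : T) : T := sub_elt (HM (sub_valP s) (sub_valP t)).
Definition sub_inv (s : T) : T := sub_elt (HV (sub_valP s)).

Lemma sub_mulA : associative sub_mul.
Proof. by move=> s t r; apply: sub_val_inj; rewrite /= mulgA. Qed.
Lemma sub_mul1 : left_id sub_one sub_mul.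
Proof. by move=> s; apply: sub_val_inj; rewrite /= mul1g. Qed.
Lemma sub_mulr1 : right_id sub_one sub_mul.
Proof. by move=> s; apply: sub_val_inj; rewrite /= mulg1. Qed.
Lemma sub_mulV : left_inverse sub_one sub_inv sub_mul.
Proof. by move=> s; apply: sub_val_inj; rewrite /= mulVg. Qed.
Lemma sub_mulrV : right_inverse sub_one sub_inv sub_mul.
Proof. by move=> s; apply: sub_val_inj; rewrite /= mulgV. Qed.

HB.instance Definition _ :=
  isGroup.Build T sub_mulA sub_mul1 sub_mulr1 sub_mulV sub_mulrV.

Lemma sub_elt_val (s : T) (Hs : H (sub_val s)) : sub_elt Hs = s.
Proof. exact: sub_val_inj. Qed.

End SubgroupType.

Section SchreierTree.
Variables (X : Type) (a : right_action F2 X) (x0 : X).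

Definition reachable (x : X) : Prop := exists u, a x0 u = x.

Local Notation lv := (letter_val gen).

(** A spanning tree of the part of the Schreier graph that is reachable from x0:
    every point is joined to a neighbour whose distance d to x0 is smaller, and
    t x is the label of the path from x0 to x in the tree. *)
Lemma schreier_transversal : exists t : X -> F2,
  [/\ t x0 = 1, forall x, reachable x -> a x0 (t x) = x &
      exists d : X -> nat, forall x, reachable x -> x <> x0 ->
        exists y l, [/\ reachable y, d y < d x, a y (lv l) = x & t x = t y * lv l]].
Proof.
pose R n x := exists2 w : word, size w = n & a x0 (word_val gen w) = x.
have reachR x : reachable x -> exists n, `[< R n x >].
  move=> [u <-]; exists (size (repr u)); apply/asboolP; exists (repr u) => //.
  by rewrite word_val_gen reprK.
pose d x := if pselect (reachable x) is left r then ex_minn (reachR x r) else 0.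
have dR x : reachable x -> R (d x) x.
  by rewrite /d => r; case: pselect => // r'; case: ex_minnP => n /asboolP.
have d_min n x : R n x -> d x <= n.
  move=> Rn; rewrite /d; case: pselect => // r; case: ex_minnP => k _; apply.
  exact/asboolP.
have R_reach n x : R n x -> reachable x by move=> [w _ <-]; exists (word_val gen w).
have d0 : d x0 = 0.
  apply/eqP; rewrite -leqn0; apply: d_min; exists [::] => //.
  by rewrite /word_val big_nil ract1.
have d0P x : reachable x -> d x = 0 -> x = x0.
  by move=> /dR Rx dx; move: Rx; rewrite dx => -[[|//] _ <-]; rewrite /word_val big_nil ract1.
have step (x : X) : exists yl : X * (bool * bool), reachable x -> d x != 0 ->
    [/\ reachable yl.1, d x = (d yl.1).+1 & a yl.1 (lv yl.2) = x].
  have [r|] := pselect (reachable x); last by exists (x, (true, true)).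
  have [w sw wx] := dR x r.
  case: (lastP w) sw wx => [<-|w' l]; first by exists (x, (true, true)).
  rewrite size_rcons => sw wx; pose y := a x0 (word_val gen w').
  have yx : a y (lv l) = x by rewrite -wx -cats1 word_val_cat ractM /word_val big_seq1.
  exists (y, l) => _ _; have Ry : R (size w') y by exists w'.
  split=> //=; first exact: R_reach Ry.
  apply/eqP; rewrite eqn_leq -{2}sw ltnS (d_min _ _ Ry) andbT.
  have [w2 sw2 w2y] := dR y (R_reach _ _ Ry).
  apply: d_min; exists (rcons w2 l); first by rewrite size_rcons sw2.
  by rewrite -cats1 word_val_cat ractM w2y /word_val big_seq1.
have [p pP] := choice step.
(* The recursion follows the tree from x to x0, in d x steps. *)
pose T := fix T n x := if n is n'.+1 then T n' (p x).1 * lv (p x).2 else 1.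
exists (fun x => T (d x) x); split; first by rewrite d0.
  move=> x; move E : (d x) => n; elim: n x E => [|n IH] x E r.
    by rewrite /= ract1 (d0P x).
  have [|r' dx ax] := pP x r; first by rewrite E.
  by move: dx; rewrite E => -[dn]; rewrite /= ractM IH.
exists d => x r x_ne; have dx0 : d x != 0 by apply: contra_notN x_ne => /eqP/(d0P x r).
have [r' dx ax] := pP x r dx0; exists (p x).1, (p x).2; split=> //.
  by rewrite dx.
by rewrite dx.
Qed.

End SchreierTree.

Section StabilizerFree.
Variables (X : Type) (a : right_action F2 X) (x0 : X).
Local Notation S := (stab a x0).
Local Notation reach := (reachable a x0).
Local Notation Stab := (subgroup_type (stab_subgroup a x0)).

Variable t : X -> F2.
Hypothesis t1 : t x0 = 1.
Hypothesis t_act : forall x, reach x -> a x0 (t x) = x.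

(** The loop at x0 that goes to x in the tree, follows u and returns in the tree. *)
Definition schreier_elt (x : X) (u : F2) : F2 := t x * u * (t (a x u))^-1.

Lemma reach_act x u : reach x -> reach (a x u).
Proof. by move=> [v <-]; exists (v * u); rewrite ractM. Qed.

Lemma t_actV x : reach x -> a x (t x)^-1 = x0.
Proof. by move=> /t_act E; rewrite -{1}E ractK. Qed.

Lemma schreier_elt_stab x u : reach x -> S (schreier_elt x u).
Proof.
move=> r; rewrite /stab /= !ractM t_act // t_actV //.
exact: reach_act.
Qed.

Lemma schreier_elt1 x : schreier_elt x 1 = 1.
Proof. by rewrite /schreier_elt mulg1 ract1 mulgV. Qed.

Lemma schreier_eltM x u v :
  schreier_elt x (u * v) = schreier_elt x u * schreier_elt (a x u) v.
Proof. by rewrite /schreier_elt ractM !mulgA mulgVK. Qed.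

Lemma schreier_elt_id u : S u -> schreier_elt x0 u = u.
Proof. by move=> Su; rewrite /schreier_elt Su t1 mul1g invg1 mulg1. Qed.

(** Any path from x0 is homotopic to the product of the loops closed up by the
    tree at each of its steps. *)
Lemma schreier_generation (K : groupType) (f h : F2 -> K) :
  (forall u v, S u -> S v -> f (u * v) = f u * f v) ->
  (forall u v, S u -> S v -> h (u * v) = h u * h v) ->
  (forall x b, reach x -> f (schreier_elt x (gen b)) = h (schreier_elt x (gen b))) ->
  forall u, S u -> f u = h u.
Proof.
move=> fM hM fh u /schreier_elt_id <-.
have r0 : reach x0 by exists 1; exact: ract1.
have sS := stab_subgroup a x0.
suff P v x : reach x -> f (schreier_elt x v) = h (schreier_elt x v) by exact: P.
elim/F2_ind: v x => [|v b IH|v b IH] x r.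
- by rewrite schreier_elt1 (subgroup_morph1 sS fM) (subgroup_morph1 sS hM).
- have r' := reach_act (gen b) r; have Sg := schreier_elt_stab (gen b) r.
  have Su := schreier_elt_stab v r'.
  by rewrite schreier_eltM fM // hM // fh // IH.
- have r' := reach_act (gen b)^-1 r.
  have E : schreier_elt x (gen b)^-1 = (schreier_elt (a x (gen b)^-1) (gen b))^-1.
    by apply/esym/mulg1_eq; rewrite -{2}(ractKV a (gen b) x) -schreier_eltM mulgV schreier_elt1.
  have Sg := schreier_elt_stab (gen b) r'; have Su := schreier_elt_stab v r'.
  have SgV := schreier_elt_stab (gen b)^-1 r; rewrite E in SgV.
  rewrite schreier_eltM E fM // hM // (subgroup_morphV sS fM) //.
  by rewrite (subgroup_morphV sS hM) // fh // IH.
Qed.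

Variable d : X -> nat.
Hypothesis t_tree : forall x, reach x -> x <> x0 ->
  exists y l, [/\ reach y, d y < d x, a y (letter_val gen l) = x &
                  t x = t y * letter_val gen l].

Definition schreier_basis : set Stab := fun s =>
  exists x b, [/\ reach x, sub_val s = schreier_elt x (gen b) & sub_val s <> 1].

(** A map f on the basis extends by the cocycle whose value on each edge outside
    the tree is the image under f of the loop through this edge, and whose value
    on the edges of the tree is 1.  The tree paths then have trivial value, and
    the value of a loop through one edge is as prescribed. *)
Lemma schreier_basis_free : free_basis schreier_basis.
Proof.
move=> K f.
(* Off the stabilizer the value is arbitrary. *)
pose f' u := if pselect (S u) is left Su then f (sub_elt _ Su) else 1.
have f'E (s : Stab) : f' (sub_val s) = f s.
  rewrite /f'; case: pselect => [Hs|]; first by rewrite sub_elt_val.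
  by have := sub_valP s.
have [c cM cE] := F2_cocycle_exists a (fun b x =>
  if schreier_elt x (gen b) == 1 then 1 else f' (schreier_elt x (gen b))).
have c_tree x : reach x -> c (t x) x0 = 1.
  move: {2}(d x) (leqnn (d x)) => n; elim: n x => [|n IH] x dx r;
    have [->|x_ne] := pselect (x = x0); rewrite ?t1 ?(cocycle_1 cM) //;
    have [y [[b e] [r' dy ya tx]]] := t_tree r x_ne; first by lia.
  rewrite tx cM IH // ?mul1g ?t_act //; last by lia.
  case: e tx ya => /= tx ya.
    rewrite (cocycle_V cM) ya cE (_ : schreier_elt _ _ = 1) ?eqxx ?invg1 //.
    by rewrite /schreier_elt -ya ractKV ya tx mulgVK mulgV.
  by rewrite cE (_ : schreier_elt _ _ = 1) ?eqxx // /schreier_elt ya tx mulgV.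
have cS u v : S u -> S v -> c (u * v) x0 = c u x0 * c v x0.
  by move=> Su Sv; rewrite cM Su.
have c_basis x b : reach x -> schreier_elt x (gen b) <> 1 ->
    c (schreier_elt x (gen b)) x0 = f' (schreier_elt x (gen b)).
  move=> r /eqP/negbTE ne; have r' := reach_act (gen b) r.
  rewrite {1}/schreier_elt -mulgA !cM t_act // c_tree // mul1g cE ne.
  by rewrite (cocycle_V cM) t_actV // c_tree // invg1 mulg1.
exists (fun s => c (sub_val s) x0); split.
  split=> [s s'|s /set_mem[x [b [r sE s1]]]].
    exact: (cS _ _ (sub_valP s) (sub_valP s')).
  by rewrite -f'E sE c_basis // -sE.
move=> phi [phiM phiB]; apply/funext => s.
pose p u := if pselect (S u) is left Su then phi (sub_elt _ Su) else 1.
have pE (r : Stab) : p (sub_val r) = phi r.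
  rewrite /p; case: pselect => [Hr|]; first by rewrite sub_elt_val.
  by have := sub_valP r.
have pS u v : S u -> S v -> p (u * v) = p u * p v.
  move=> Su Sv; pose su : Stab := sub_elt _ Su; pose sv : Stab := sub_elt _ Sv.
  by rewrite (pE (su * sv)) (pE su) (pE sv) phiM.
rewrite -pE; apply: (@schreier_generation K (fun u => c u x0) p cS pS _ _ (sub_valP s)) => x b r.
have [E|ne] := pselect (schreier_elt x (gen b) = 1).
  rewrite E (cocycle_1 cM); pose one : Stab := 1.
  by rewrite (pE one) (morph_1 phiM).
rewrite c_basis //; pose y : Stab := sub_elt _ (schreier_elt_stab (gen b) r).
rewrite (pE y) (f'E y) phiB //; apply: mem_set.
by exists x, b.
Qed.

End StabilizerFree.

(** A subgroup H is the stabilizer of the coset H in the action of F2 on its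
    subsets by right translation. *)
Theorem subgroup_free (H : set F2) (sH : is_subgroup H) :
  is_free (subgroup_type sH).
Proof.
pose act (A : set F2) (u : F2) : set F2 := fun v => A (v * u^-1).
have act1 A : act A 1 = A by apply/funext => v; rewrite /act invg1 mulg1.
have actM A u v : act A (u * v) = act (act A u) v.
  by apply/funext => w; rewrite /act invgM mulgA.
pose a := RightAction act1 actM; have [H1 HM HV] := sH.
have stabE : stab a H = H.
  apply/seteqP; split=> [u Su|u Hu]; rewrite /stab /= /act.
    by rewrite -[H]Su /= /act mulgV.
  apply/funext => v; apply/propext; split=> Hv; last by apply: HM => //; exact: HV.
  by rewrite -(mulgVK u v); exact: HM.
have free_stab A (sA : is_subgroup A) : A = stab a H -> is_free (subgroup_type sA).
  move=> E; subst A; rewrite (Prop_irrelevance sA (stab_subgroup a H)).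
  have [t [t1 t_act [d t_tree]]] := schreier_transversal a H.
  exists (schreier_basis (a := a) (x0 := H) t); exact: schreier_basis_free t_tree.
exact: free_stab.
Qed.

(** * Maps onto F2 and the action on cosets *)

(** If all elements of the basis commuted, conjugation by any of them would fix
    the basis, hence be the identity, and the group would be abelian.  Two basis
    elements that do not commute can be sent to the generators of F2 and the other
    ones to 1. *)
Lemma free_non_abelian_onto (F : groupType) : is_free F -> non_abelian F ->
  exists2 p : F -> F2, {morph p : x y / x * y} & forall u, exists x, p x = u.
Proof.
move=> [B freeB] [x0 [y0 xy0]].
have [b1 [b2 [B1 B2 b12]]] : exists b1 b2, [/\ B b1, B b2 & b1 * b2 <> b2 * b1].
  apply: contrapT => com; apply: xy0.
  have [phi [_ phi_uniq]] := freeB F id.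
  have phiid : phi = id by apply: phi_uniq; split=> // x y.
  have central x : (forall b, B b -> x * b = b * x) -> forall y, x * y = y * x.
    move=> xB y; have E : phi = (fun z => z ^ x).
      apply: phi_uniq; split=> [u v|b /set_mem Bb]; first exact: conjMg.
      by rewrite /conjg -xB // mulKg.
    by have := congr1 (fun h => x * h y) E; rewrite phiid /conjg mulVKg.
  apply: (central) => b Bb; apply/esym; apply: (central) => b' Bb'.
  by apply: contrapT => nc; apply: com; exists b, b'.
have b_ne : b1 <> b2 by move=> E; apply: b12; rewrite E.
have [p [[pM pB] _]] := freeB F2
  (fun b => if b == b1 then gen false else if b == b2 then gen true else 1).
exists p => // u; elim/F2_ind: u => [|u b [x <-]|u b [x <-]].
- by exists 1; exact: morph_1.
- exists ((if b then b2 else b1) * x); rewrite pM; congr (_ * _).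
  case: b; rewrite pB ?mem_set // ?eqxx //.
  by case: eqP => // E; case: b_ne.
- exists ((if b then b2 else b1)^-1 * x); rewrite pM (morph_V pM); congr (_^-1 * _).
  case: b; rewrite pB ?mem_set // ?eqxx //.
  by case: eqP => // E; case: b_ne.
Qed.

(** The image of f is a subgroup of F2, so it is free. *)
Lemma large_to_F2 (G : groupType) (H : set G) (f : G -> F2) :
  finite_index H -> {in H &, {morph f : x y / x * y}} ->
  (exists x y, [/\ H x, H y & f x * f y <> f y * f x]) -> large G.
Proof.
move=> fH fM [x [y [Hx Hy xy]]]; exists H => //.
have [[H1 HM HV] _] := fH.
have {}fM u v : H u -> H v -> f (u * v) = f u * f v.
  by move=> Hu Hv; apply: fM; apply: mem_set.
pose I : set F2 := (f @` H)%classic.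
have sI : is_subgroup I.
  split; first by exists 1; rewrite ?(subgroup_morph1 (proj1 fH) fM).
    move=> _ _ [u Hu <-] [v Hv <-]; exists (u * v); first exact: HM.
    exact: fM.
  move=> _ [u Hu <-]; exists u^-1; first exact: HV.
  exact: (subgroup_morphV (proj1 fH) fM).
have If u : H u -> I (f u) by move=> Hu; exists u.
pose h u : subgroup_type sI := if pselect (H u) is left Hu then sub_elt sI (If u Hu) else 1.
have hE u : H u -> sub_val (h u) = f u by rewrite /h; case: pselect.
exists (subgroup_type sI), h; split.
- exact: subgroup_free.
- exists (h x), (h y) => /(congr1 (@sub_val _ _ _)) /=.
  by rewrite !hE.
- move=> u v /set_mem Hu /set_mem Hv; apply: sub_val_inj; rewrite /= !hE ?fM //.
  exact: HM.
- apply/seteqP; split=> // s _; have [u Hu us] := sub_valP s.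
  by exists u => //; apply: sub_val_inj; rewrite hE.
Qed.

Section Cosets.
Variables (G : groupType) (H : set G).

Lemma lcoset_set_eq x y : is_subgroup H ->
  lcoset_set H x = lcoset_set H y <-> H (x^-1 * y).
Proof.
move=> [H1 HM HV]; split=> [E|Hxy].
  have : lcoset_set H y y by exists 1 => //; exact: mulg1.
  by rewrite -E => -[h Hh <-]; rewrite mulKg.
apply/seteqP; split=> [_ [h Hh <-]|_ [h Hh <-]].
  exists ((x^-1 * y)^-1 * h); first by apply: HM => //; exact: HV.
  by rewrite invgM invgK !mulgA mulgV mul1g.
by exists (x^-1 * y * h); [exact: HM|rewrite !mulgA mulgV mul1g].
Qed.

Hypothesis fH : finite_index H.
Let sH : is_subgroup H. Proof. by case: fH. Qed.
Let H1 : H 1. Proof. by case: sH. Qed.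
Let HV x : H x -> H x^-1. Proof. by case: sH => _ _; apply. Qed.

Local Notation cosets := (fset_set (lcoset_space H)).

Let mem_cosets A : (A \in cosets) = (A \in lcoset_space H).
Proof. by rewrite in_fset_set //; case: fH. Qed.

Let cosetP x : lcoset_set H x \in cosets.
Proof. by rewrite mem_cosets; apply: mem_set; exists x. Qed.

Definition coset_rep (A : cosets) : G :=
  xget 1 [set x | lcoset_set H x = val A]%classic.

Let coset_repE A : lcoset_set H (coset_rep A) = val A.
Proof.
have : val A \in lcoset_space H by rewrite -mem_cosets; exact: valP.
by rewrite /coset_rep => /set_mem[x _ xA]; case: xgetP => [y -> //|/(_ x)].
Qed.

Definition coset_of_elt (x : G) : cosets := [` cosetP x]%fset.

Let coset_eqP x y : coset_of_elt x = coset_of_elt y <-> H (x^-1 * y).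
Proof.
rewrite -lcoset_set_eq //; split=> [/(congr1 val) //|E]; exact: val_inj.
Qed.

Let coset_repK A : coset_of_elt (coset_rep A) = A.
Proof. by apply: val_inj; rewrite /= coset_repE. Qed.

(** Left translation by x^-1, on representatives; a right action. *)
Definition coset_act (A : cosets) (x : G) : cosets := coset_of_elt (x^-1 * coset_rep A).

Let coset_actE x y : coset_act (coset_of_elt y) x = coset_of_elt (x^-1 * y).
Proof.
apply/coset_eqP; rewrite invgM invgK -!mulgA mulVKg.
by apply/coset_eqP; rewrite coset_repK.
Qed.

Lemma coset_act1 A : coset_act A 1 = A.
Proof. by rewrite -[A]coset_repK coset_actE invg1 mul1g. Qed.

Lemma coset_actM A x y : coset_act A (x * y) = coset_act (coset_act A x) y.
Proof. by rewrite -[A]coset_repK !coset_actE invgM mulgA. Qed.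

Definition coset_action : right_action G cosets := RightAction coset_act1 coset_actM.

Definition coset_perm (x : G) : {perm cosets} := perm (can_inj (ractK coset_action x)).

Lemma coset_permM : {morph coset_perm : x y / x * y}.
Proof. by move=> x y; apply/perm.permP => A; rewrite permM !permE /= coset_actM. Qed.

Lemma coset_perm_ker x : coset_perm x = 1 -> H x.
Proof.
move=> /perm.permP/(_ (coset_of_elt 1)); rewrite permE perm1 /= coset_actE mulg1.
by move/coset_eqP; rewrite invgK mulg1.
Qed.

Lemma finite_index_exponent : exists2 N, 0 < N & forall x, H (x ^+ N).
Proof.
exists #|[set: {perm cosets}]|; first by apply/card_gt0P; exists 1.
move=> x; apply: coset_perm_ker; rewrite (morph_X coset_permM).
by apply: cyclic.expg_cardG; rewrite inE.
Qed.

(** For normal H, the permutations of the cosets coming from G form a regular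
    group, whose order is therefore the index of H. *)
Lemma normal_index_exponent x : is_normal_subgroup H -> H (x ^+ subgroup_index H).
Proof.
move=> [_ HJ].
pose K : {set {perm cosets}} := [set s | `[< exists x, coset_perm x = s >]].
have KP s : reflect (exists x, coset_perm x = s) (s \in K).
  by rewrite inE; exact: asboolP.
have gK : group_set K.
  apply/group_setP; split=> [|_ _ /KP[y <-] /KP[z <-]].
    by apply/KP; exists 1; exact: (morph_1 coset_permM).
  by apply/KP; exists (y * z); exact: coset_permM.
have cardK : #|K| = subgroup_index H.
  rewrite /subgroup_index cardfE -cardsT.
  pose ev (s : {perm cosets}) := s (coset_of_elt 1).
  have ev_inj : {in K &, injective ev}.
    move=> _ _ /KP[y <-] /KP[z <-]; rewrite /ev !permE /= !coset_actE !mulg1.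
    move=> /coset_eqP; rewrite invgK => Hyz; apply/perm.permP => A; rewrite !permE /=.
    rewrite -[A]coset_repK !coset_actE; set t := coset_rep A; apply/coset_eqP.
    by have := HJ _ t Hyz; rewrite /conjg invgM invgK !mulgA.
  rewrite -(card_in_imset ev_inj); apply: eq_card => A; rewrite !inE.
  apply/imsetP; exists (coset_perm (coset_rep A)^-1); first by apply/KP; eexists.
  by rewrite /ev permE /= coset_actE invgK mulg1 coset_repK.
apply: coset_perm_ker; rewrite (morph_X coset_permM) -cardK.
by apply: (@cyclic.expg_cardG _ (group gK)); apply/KP; exists x.
Qed.

End Cosets.

(** * Large quotients by powers *)

(** The coset of x is determined by its coset modulo H and, t being the chosen
    representative of the latter, by the coset of f (t^-1 x) modulo S. *)
Lemma finite_index_preimage (G K : groupType) (H : set G) (S : set K) (f : G -> K) :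
  finite_index H -> finite_index S ->
  (forall x y, H x -> H y -> f (x * y) = f x * f y) ->
  finite_index (fun x => H x /\ S (f x)).
Proof.
move=> [sH finH] [sS finS] fM; have [H1 HM HV] := sH; have [S1 SM SV] := sS.
have f1 := subgroup_morph1 sH fM; have fV := subgroup_morphV sH fM.
pose t (A : set G) : G := xget 1 [set x | lcoset_set H x = A]%classic.
have tH x : H ((t (lcoset_set H x))^-1 * x).
  by apply/(lcoset_set_eq _ _ sH); rewrite /t; case: xgetP => [y _ //|/(_ x)/(_ erefl)].
pose c x := (lcoset_set H x, lcoset_set S (f ((t (lcoset_set H x))^-1 * x))).
apply: (@finite_index_by _ _ _ c).
- split; first by rewrite f1.
    by move=> x y [Hx Sx] [Hy Sy]; rewrite fM //; split; [exact: HM|exact: SM].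
  by move=> x [Hx Sx]; rewrite fV //; split; [exact: HV|exact: SV].
- apply: sub_finite_set (finite_setX finH finS) => _ [x _ <-].
  by split=> /=; [exists x|eexists].
- move=> x y [Hxy]; rewrite -Hxy => /(lcoset_set_eq _ _ sS).
  have Hx := tH x; have := tH y; rewrite -Hxy; set z := t _ in Hx * => Hy.
  rewrite -fV // -fM //; last exact: HV.
  rewrite invgM invgK -!mulgA mulVKg => Sxy; split=> //.
  exact/(lcoset_set_eq _ _ sH).
Qed.

Section Quotient.
Variables (G : groupType) (A : set G).
Local Notation pi := (\pi_(nc_quotient A)).

Lemma finite_index_quotient (H : set G) : finite_index H ->
  (forall y, normal_closure A y -> H y) ->
  finite_index (fun q : nc_quotient A => H (repr q)).
Proof.
move=> [[H1 HM HV] finH] AH.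
have Hpi y : H (repr (pi y)) <-> H y.
  have : normal_closure A (y^-1 * repr (pi y)).
    apply/nc_quotient_ker; rewrite nc_quotient_piM reprK.
    by rewrite (morph_V (@nc_quotient_piM _ A)) mulVg.
  move=> /AH Hd; split=> Hy.
    rewrite -(invgK y); apply: (HV); rewrite -(mulgK (repr (pi y)) y^-1).
    by apply: HM => //; exact: HV.
  by rewrite -(mulVKg y (repr (pi y))); exact: HM.
apply: (@finite_index_by (nc_quotient A) _ _ (fun q : nc_quotient A => lcoset_set H (repr q))).
- split; first exact/Hpi.
    move=> p q Hp Hq; rewrite -[p]reprK -[q]reprK -nc_quotient_piM; apply/Hpi.
    exact: HM.
  move=> p Hp; rewrite -[p]reprK -(morph_V (@nc_quotient_piM _ A)); apply/Hpi.
  exact: HV.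
- by apply: sub_finite_set finH => _ [q _ <-]; exists (repr q).
- move=> p q /lcoset_set_eq E; rewrite -[p]reprK -[q]reprK.
  by rewrite -(morph_V (@nc_quotient_piM _ A)) -nc_quotient_piM; apply/Hpi/E.
Qed.

(** If A dies under f, then f descends to the image of H in the quotient, where it
    can be computed on representatives. *)
Lemma large_quotient (H : set G) (f : G -> F2) : finite_index H ->
  (forall x y, H x -> H y -> f (x * y) = f x * f y) ->
  (exists x y, [/\ H x, H y & f x * f y <> f y * f x]) ->
  (forall y, normal_closure A y -> H y /\ f y = 1) -> large (nc_quotient A).
Proof.
move=> fH fM [x [y [Hx Hy xy]]] fA; have [[H1 HM HV] _] := fH.
have pi_repr z : exists2 d, normal_closure A d & repr (pi z) = z * d.
  exists (z^-1 * repr (pi z)); last by rewrite mulVKg.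
  apply/nc_quotient_ker; rewrite nc_quotient_piM reprK.
  by rewrite (morph_V (@nc_quotient_piM _ A)) mulVg.
have Hpi z : H z -> H (repr (pi z)) /\ f (repr (pi z)) = f z.
  move=> Hz; have [d /fA[Hd fd] ->] := pi_repr z.
  by split; [exact: HM|rewrite fM // fd mulg1].
apply: (@large_to_F2 (nc_quotient A) (fun q : nc_quotient A => H (repr q))
  (fun q : nc_quotient A => f (repr q))).
- by apply: finite_index_quotient => // z /fA[].
- move=> p q /set_mem Hp /set_mem Hq.
  rewrite -{1}[p]reprK -{1}[q]reprK -nc_quotient_piM -fM //.
  by apply: (Hpi _ _).2; exact: HM.
- exists (pi x), (pi y); have [? ->] := Hpi x Hx; have [? ->] := Hpi y Hy.
  by split.
Qed.

End Quotient.

Section PowerQuotient.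
Variables (G : groupType) (r : nat) (g : 'I_r -> G) (H : set G).
Hypothesis fH : finite_index H.
Hypothesis onto_free : maps_onto_non_abelian_free H.

(** The m-th powers of the images of the conjugates of g i ^ N lie in the normal
    subgroup K of F2 given by [free_power_quotient], because up to conjugacy in
    F2 it is enough to conjugate by representatives of the cosets of H.  The
    elements all of whose conjugates lie in H and are mapped to K form a normal
    subgroup of G, and so contain the normal closure. *)
Lemma large_power_quotient N : (forall x, H (x ^+ N)) -> exists m0, forall m, m0 <= m ->
  large (nc_quotient (range (fun i : 'I_r => g i ^+ (N * m)))).
Proof.
move=> HN; have [sH finH] := fH; have [H1 HM HV] := sH.
have [F [f [freeF abF fM0 fH_onto]]] := onto_free.
have [p pM p_onto] := free_non_abelian_onto freeF abF.
pose psi x := p (f x).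
have psiM x y : H x -> H y -> psi (x * y) = psi x * psi y.
  by move=> Hx Hy; rewrite /psi fM0 ?pM //; exact: mem_set.
have psi_onto u : exists2 x, H x & psi x = u.
  have [z <-] := p_onto u; have : (f @` H)%classic z by rewrite fH_onto.
  by move=> [x Hx <-]; exists x.
have psi1 := subgroup_morph1 sH psiM; have psiV := subgroup_morphV sH psiM.
have [ts tsP] : exists ts : seq G, forall t, exists2 t', t' \in ts & H (t'^-1 * t).
  have /finite_seqP[cs csE] := finH.
  pose rep (C : set G) : G := xget 1 [set x | lcoset_set H x = C]%classic.
  exists (map rep cs) => t; exists (rep (lcoset_set H t)).
    apply: map_f; have : lcoset_space H (lcoset_set H t) by exists t.
    by rewrite csE.
  by apply/(lcoset_set_eq _ _ sH); rewrite /rep; case: xgetP => [y _ //|/(_ t)/(_ erefl)].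
pose fs := [seq psi ((g i ^+ N) ^ t) | i <- enum 'I_r, t <- ts].
have [m0 m0P] := free_power_quotient fs; exists m0 => m /m0P.
move=> [S [K [chi [fS chiM [u [v [Su Sv uv]]] [[K1 KM KV] KJ] [KS chiK Kfs]]]]].
have HNJ x t : H ((x ^+ N) ^ t) by rewrite conjXg; exact: HN.
pose M : set G := fun y => forall t, H (y ^ t) /\ K (psi (y ^ t)).
have MJ x y : M x -> M (x ^ y) by move=> Mx t; rewrite -conjgM; exact: Mx.
have nM : is_normal_subgroup M.
  split=> //; split.
  - by move=> t; rewrite conj1g psi1.
  - move=> x y Mx My t; have [Hx Kx] := Mx t; have [Hy Ky] := My t.
    by rewrite conjMg psiM //; split; [exact: HM|exact: KM].
  - move=> x Mx t; have [Hx Kx] := Mx t.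
    by rewrite conjVg psiV //; split; [exact: HV|exact: KV].
have gM : (range (fun i : 'I_r => g i ^+ (N * m)) `<=` M)%classic.
  move=> _ [i _ <-] t; rewrite expgnA conjXg; split; first exact: subgroup_X.
  rewrite (subgroup_morphX sH psiM) //; have [t' t'ts Ht] := tsP t.
  rewrite -(mulVKg t' t) conjgM; set h := t'^-1 * t in Ht *.
  rewrite (subgroup_morphJ sH psiM) //.
  rewrite -conjXg; apply: (KJ); apply: Kfs.
  by apply: allpairs_f => //; rewrite mem_enum.
have clM y : normal_closure (range (fun i : 'I_r => g i ^+ (N * m))) y -> M y.
  by move=> cy; apply: cy; split.
apply: (@large_quotient _ _ (fun y => H y /\ S (psi y)) (fun y => chi (psi y))).
- exact: finite_index_preimage.
- move=> x y [Hx Sx] [Hy Sy]; rewrite psiM // chiM //; exact: mem_set.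
- have [x Hx xu] := psi_onto u; have [y Hy yv] := psi_onto v.
  by exists x, y; rewrite xu yv.
- move=> y /clM/(_ 1); rewrite conjg1 => -[Hy Ky].
  by split; [split=> //; exact: KS|exact: chiK].
Qed.

End PowerQuotient.

Local Close Scope group_scope.
Local Close Scope quotient_scope.

Theorem theorem1p1 (G : groupType) (r : nat) (g : 'I_r -> G) :
  finitely_generated G -> large G ->
  infinite_set [set n : nat |
    large (nc_quotient (range (fun i : 'I_r => (g i ^+ n)%g)))]%classic /\
  forall H : set G,
    is_normal_subgroup H -> finite_index H -> maps_onto_non_abelian_free H ->
    exists n0 : nat, forall n : nat, n0 <= n -> subgroup_index H %| n ->
      large (nc_quotient (range (fun i : 'I_r => (g i ^+ n)%g))).
Proof.
move=> _ [H0 fH0 onto0]; split.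
  have [N N_gt0 HN] := finite_index_exponent fH0.
  have [m0 Hm] := large_power_quotient g fH0 onto0 HN.
  move=> finA; apply: infinite_nat.
  (* h maps the admissible exponent N * (k + m0) to k. *)
  pose h n := ((n - N * m0) %/ N)%N.
  pose B := [set n | large (nc_quotient (range (fun i => (g i ^+ n)%g)))]%classic.
  apply: (@sub_finite_set _ _ (h @` B)%classic); last exact: finite_image.
  move=> k _; exists (N * (k + m0))%N; first by apply: Hm; exact: leq_addl.
  by rewrite /h mulnDr addnK mulKn.
move=> H nH fH ontoH.
have [m0 Hm] := large_power_quotient g fH ontoH (fun x => normal_index_exponent fH x nH).
exists (subgroup_index H * m0)%N.+1 => n lt_n /dvdnP[m nE].
rewrite nE mulnC; apply: Hm.
move: lt_n; rewrite nE [(m * _)%N]mulnC; case: (subgroup_index H) => [|k].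
  by rewrite !mul0n.
by move/ltnW; rewrite leq_pmul2l.
Qed.
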